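(* Let $n,m\ge 0$ be integers and $R>0$. The volume of the complex projective superspace $\mathbf{CP}^{n|m}_R$, i.e. $\mathbf{CP}^{n|m}$ equipped with the Fubini--Study structure of scale $R$, is $$\operatorname{vol}(\mathbf{CP}^{n|m}_R)=R^{2(n-m)}\,\frac{\pi^n\,2^m}{\Gamma(n-m+1)},$$ where $1/\Gamma$ is understood to be $0$ at the poles of $\Gamma$.
   Context: $\mathbf{CP}^{n|m}=(\mathbf C^{n+1|m}\setminus\{0\})/\mathbf C^*$ is the quotient of the space of nonzero (even) vectors. With homogeneous coordinates $z^a$ (even, $n+1$ of them) and $\zeta^\mu$ (odd, $m$ of them), the $k$th affine chart has inhomogeneous coordinates $w^a=z^a/z^k$ ($a\ne k$, so $n$ of them, relabelled $w^1,\dots,w^n$) and $\theta^\mu=\zeta^\mu/z^k$. Put $$N=1+\sum_{a=1}^n w^a\bar w^a+i\sum_{\mu=1}^m\theta^\mu\bar\theta^\mu .$$ The Fubini--Study symplectic form of scale $R$ is $\omega=\frac i2R^2\,\partial\bar\partial\ln N$; it is characterized by $p^*\omega=i^*\omega_0$, where $i:\mathbf S^{2n+1|2m}_R\to\mathbf C^{n+1|m}\setminus\{0\}$ is the inclusion of the supersphere $\sum z^a\bar z^a+i\sum\zeta^\mu\bar\zeta^\mu=R^2$, $p:\mathbf S^{2n+1|2m}_R\to\mathbf{CP}^{n|m}$ is the (Hopf) projection, and $\omega_0=\frac i2\bigl(\sum dz^a\,d\bar z^a-i\sum d\zeta^\mu\,d\bar\zeta^\mu\bigr)$. The corresponding volume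 element, which is both the Liouville volume element of the symplectic structure and the volume element of the corresponding Riemannian metric, is in each affine chart $$dV_{\mathbf{CP}^{n|m}_R}=R^{2(n-m)}\left(\frac i2\right)^{n-m}\frac{[dw^1,d\bar w^1,\dots,dw^n,d\bar w^n\,|\,d\theta^1,d\bar\theta^1,\dots,d\theta^m,d\bar\theta^m]}{N^{n-m+1}} .$$ The volume is the Berezin integral of this volume element over $\mathbf{CP}^{n|m}$. The bracket $[\,\cdot\,|\,\cdot\,]$ denotes the Berezin coordinate volume element; it transforms by the Berezinian, so that for $w^a=u^a+iv^a$, $\theta^\mu=\sigma^\mu+i\tau^\mu$ (real and imaginary parts) one has $\left(\frac i2\right)^{n-m}[dw,d\bar w\,|\,d\theta,d\bar\theta]=[du,dv\,|\,d\sigma,d\tau]$. The Berezin integral is normalized so that the integral of $\exp\bigl(-\sum_a((u^a)^2+(v^a)^2)-2\sum_\mu\sigma^\mu\tau^\mu\bigr)$ with respect to $[du,dv\,|\,d\sigma,d\tau]$ equals $\pi^n2^m$. Note $i\theta^\mu\bar\theta^\mu=2\sigma^\mu\tau^\mu$. *)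

(* Defs.v *)
(* MathComp / MathComp-Analysis development, over an arbitrary R : realType;
   complex numbers are R[i]. *)
From HB Require Import structures.
From mathcomp Require Import all_boot all_order all_algebra.
From mathcomp Require Import boolp.
Set Implicit Arguments.
Unset Strict Implicit.
Unset Printing Implicit Defensive.
Import Order.TTheory GRing.Theory Num.Theory.
Local Open Scope ring_scope.

Definition inversions (d : Order.disp_t) (I : finOrderType d) (A B : {set I}) : nat :=
  (\sum_(a in A) \sum_(b in B) (b < a)%O)%N.

(* The Grassmann (exterior) algebra over K on generators indexed by a finite
   totally ordered set I.  The coefficient at A : {set I} is that of the
   monomial e_A, the product of the generators of A in increasing order, so
   that e_A e_B = gsign A B e_(A :|: B). *)
Definition grassmann (d : Order.disp_t) (I : finOrderType d) (K : comNzRingType) : Type :=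
  {ffun {set I} -> K}.

Section GrassmannAlgebra.
Context (d : Order.disp_t) (I : finOrderType d) (K : comNzRingType).
Local Notation G := (grassmann I K).

HB.instance Definition _ := GRing.Lmodule.copy G {ffun {set I} -> K^o}.

Definition gsign (A B : {set I}) : K :=
  if [disjoint A & B] then (-1) ^+ inversions A B else 0.

Definition gone : G := [ffun A => (A == set0)%:R].

Definition gmul (x y : G) : G :=
  [ffun A : {set I} =>
     \sum_B \sum_(C | B :|: C == A) gsign B C * (x B * y C)].

Lemma inversionsUl (A B C : {set I}) : [disjoint A & B] ->
  inversions (A :|: B) C = (inversions A C + inversions B C)%N.
Proof.
move=> dAB; rewrite /inversions -bigU //=.
by apply: eq_bigl => i; rewrite !inE.
Qed.

Lemma inversionsUr (A B C : {set I}) : [disjoint B & C] ->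
  inversions A (B :|: C) = (inversions A B + inversions A C)%N.
Proof.
move=> dBC; rewrite /inversions -big_split /=; apply: eq_bigr => a _.
by rewrite -bigU //=; apply: eq_bigl => i; rewrite !inE.
Qed.

Lemma gsignA (A B C : {set I}) :
  gsign A B * gsign (A :|: B) C = gsign A (B :|: C) * gsign B C.
Proof.
rewrite /gsign.
have -> : [disjoint A :|: B & C] = [disjoint A & C] && [disjoint B & C].
  by rewrite -!setI_eq0 setIUl setU_eq0.
have -> : [disjoint A & B :|: C] = [disjoint A & B] && [disjoint A & C].
  by rewrite -!setI_eq0 setIUr setU_eq0.
have [dAB|_] := boolP [disjoint A & B]; last by rewrite !mul0r.
have [dAC|_] := boolP [disjoint A & C]; last by rewrite mulr0 mul0r.
have [dBC|_] := boolP [disjoint B & C]; last by rewrite !mulr0.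
by rewrite inversionsUl // inversionsUr // -!exprD addnA.
Qed.

Lemma gsign0l A : gsign set0 A = 1.
Proof. by rewrite /gsign -setI_eq0 set0I eqxx /inversions big_set0. Qed.

Lemma gsign0r A : gsign A set0 = 1.
Proof.
rewrite /gsign -setI_eq0 setI0 eqxx /inversions big1 // => a _.
by rewrite big_set0.
Qed.


Let big_collapse (P : {set I} -> {set I} -> bool)
    (F : {set I} -> {set I} -> {set I} -> {set I} -> K) :
  \sum_D \sum_(C | P D C) \sum_A \sum_(B | A :|: B == D) F A B C D =
  \sum_A \sum_B \sum_(C | P (A :|: B) C) F A B C (A :|: B).
Proof.
transitivity (\sum_D \sum_A \sum_(B | A :|: B == D) \sum_(C | P D C) F A B C D).
  apply: eq_bigr => D _; rewrite exchange_big /=; apply: eq_bigr => A _.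
  by rewrite exchange_big.
rewrite exchange_big /=; apply: eq_bigr => A _.
rewrite (exchange_big_dep xpredT) //=; apply: eq_bigr => B _.
by rewrite (big_pred1 (A :|: B)) // => D; rewrite eq_sym.
Qed.

Lemma gmulA : associative gmul.
Proof.
move=> x y z; apply/ffunP => E; rewrite !ffunE.
transitivity (\sum_A \sum_B \sum_(C | A :|: B :|: C == E)
    gsign A B * gsign (A :|: B) C * (x A * (y B * z C))).
  under eq_bigr => A _.
    under eq_bigr => D _.
      rewrite ffunE mulr_sumr mulr_sumr.
      under eq_bigr => B _ do rewrite mulr_sumr mulr_sumr.
      over.
    over.
  apply: eq_bigr => A _.
  rewrite (exchange_big_dep xpredT) //=; apply: eq_bigr => B _.
  rewrite (exchange_big_dep xpredT) //= [RHS]big_mkcond /=.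
  apply: eq_bigr => C _; case: ifP => [/eqP ABC|nABC].
    rewrite (big_pred1 (B :|: C)); last first.
      move=> D; rewrite andbC [RHS]eq_sym /=; case: eqP => //= <-.
      by rewrite setUA ABC eqxx.
    by rewrite gsignA -!mulrA; congr (_ * _); rewrite mulrCA.
  rewrite big_pred0 // => D; rewrite andbC; case: eqP => //= <-.
  by rewrite setUA nABC.
rewrite -(big_collapse (fun D C => D :|: C == E)
  (fun A B C D => gsign A B * gsign D C * (x A * (y B * z C)))) /=; apply: eq_bigr => D _; apply: eq_bigr => C _.
rewrite ffunE mulr_suml mulr_sumr; apply: eq_bigr => A _.
rewrite mulr_suml mulr_sumr; apply: eq_bigr => B _.
by rewrite -!mulrA mulrCA.
Qed.

Lemma gmul1l : left_id gone gmul.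
Proof.
move=> x; apply/ffunP => A; rewrite ffunE (bigD1 set0) //= [X in _ + X]big1.
  rewrite addr0 (big_pred1 A) => [|C]; last by rewrite set0U.
  by rewrite gsign0l ffunE eqxx !mul1r.
by move=> B /negbTE B0; apply: big1 => C _; rewrite ffunE B0 mul0r mulr0.
Qed.

Lemma gmul1r : right_id gone gmul.
Proof.
move=> x; apply/ffunP => A; rewrite ffunE.
under eq_bigr do rewrite big_mkcond.
rewrite exchange_big (bigD1 set0) //= [X in _ + X]big1.
  rewrite addr0 -big_mkcond (big_pred1 A) => [|C]; last by rewrite setU0.
  by rewrite gsign0r ffunE eqxx mul1r mulr1.
move=> B /negbTE B0; apply: big1 => C _; case: ifP => // _.
by rewrite ffunE B0 !mulr0.
Qed.

Lemma gmulDl : left_distributive gmul +%R.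
Proof.
move=> x y z; apply/ffunP => A; rewrite !ffunE -big_split; apply: eq_bigr => B _.
by rewrite -big_split; apply: eq_bigr => C _; rewrite ffunE mulrDl mulrDr.
Qed.

Lemma gmulDr : right_distributive gmul +%R.
Proof.
move=> x y z; apply/ffunP => A; rewrite !ffunE -big_split; apply: eq_bigr => B _.
by rewrite -big_split; apply: eq_bigr => C _; rewrite ffunE !mulrDr.
Qed.

Lemma gone_neq0 : gone != 0.
Proof.
by apply/eqP => /ffunP/(_ set0); rewrite !ffunE eqxx => /eqP; rewrite oner_eq0.
Qed.

HB.instance Definition _ := GRing.Zmodule_isNzRing.Build G
  gmulA gmul1l gmul1r gmulDl gmulDr gone_neq0.

Lemma gscaleAl (a : K) (x y : G) : a *: (x * y) = a *: x * y.
Proof.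
apply/ffunP => A; rewrite !ffunE [LHS]mulr_sumr; apply: eq_bigr => B _.
by rewrite mulr_sumr; apply: eq_bigr => C _; rewrite ffunE mulrCA -!mulrA.
Qed.

HB.instance Definition _ := GRing.Lmodule_isLalgebra.Build K G gscaleAl.

Lemma gscaleAr (a : K) (x y : G) : a *: (x * y) = x * (a *: y).
Proof.
apply/ffunP => A; rewrite !ffunE [LHS]mulr_sumr; apply: eq_bigr => B _.
rewrite mulr_sumr; apply: eq_bigr => C _; rewrite ffunE mulrCA.
by congr (_ * _); rewrite mulrCA.
Qed.

HB.instance Definition _ := GRing.Lalgebra_isAlgebra.Build K G gscaleAr.

(* As for any ring, the inverse is the two-sided inverse when it exists; an
   element is invertible as soon as its coefficient at set0 is. *)
Let gunit (x : G) : bool := `[< exists y, y * x = 1 /\ x * y = 1 >].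
Let ginv (x : G) : G :=
  if pselect (exists y, y * x = 1 /\ x * y = 1) is left e then projT1 (cid e) else x.

Let gmulVr : {in gunit, left_inverse 1 ginv *%R}.
Proof.
by move=> x /asboolP e; rewrite /ginv; case: pselect => // e'; case: cid => y [].
Qed.

Let gmulrV : {in gunit, right_inverse 1 ginv *%R}.
Proof.
by move=> x /asboolP e; rewrite /ginv; case: pselect => // e'; case: cid => y [].
Qed.

Let gunitP (x y : G) : y * x = 1 /\ x * y = 1 -> gunit x.
Proof. by move=> xy; apply/asboolP; exists y. Qed.

Let ginv_out : {in [predC gunit], ginv =1 id}.
Proof.
by move=> x /asboolPn e; rewrite /ginv; case: pselect.
Qed.

HB.instance Definition _ := GRing.NzRing_hasMulInverse.Build G
  gmulVr gmulrV gunitP ginv_out.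

Definition ggen (i : I) : G := [ffun A => (A == [set i])%:R].

Definition gtop (x : G) : K := x [set: I].
End GrassmannAlgebra.

From mathcomp Require Import complex.
From mathcomp Require Import all_classical all_reals all_analysis.
Import numFieldNormedType.Exports.
Local Open Scope classical_set_scope.
Local Open Scope ring_scope.

Lemma sigma_finite_prod d1 d2 (T1 : measurableType d1) (T2 : measurableType d2)
    (R : realType) (m1 : {sigma_finite_measure set T1 -> \bar R})
    (m2 : {sigma_finite_measure set T2 -> \bar R}) :
  sigma_finite setT (m1 \x m2)%E.
Proof.
have /sigma_finiteP[F [TF ndF Foo]] := sigma_finiteT m1.
have /sigma_finiteP[G [TG ndG Goo]] := sigma_finiteT m2.
exists (fun n => F n `*` G n).
  rewrite -setXTT TF TG predeqE => -[x y]; split.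
    move=> [/= [n _ Fnx] [k _ Gky]]; exists (maxn n k) => //; split.
    - by move: x Fnx; exact/subsetPset/ndF/leq_maxl.
    - by move: y Gky; exact/subsetPset/ndG/leq_maxr.
  by move=> [n _ []/= ? ?]; split; exists n.
move=> k; have [? ?] := Foo k; have [? ?] := Goo k.
split; first exact: measurableX.
by rewrite product_measure1E// lte_mul_pinfty// ge0_fin_numE.
Qed.

(* The n-fold product measure on n.-tuple T. *)
Section TupleMeasure.
Context (dT : measure_display) (T : measurableType dT) (R : realType).
Variable mu : {sigma_finite_measure set T -> \bar R}.

Definition tcons (n : nat) (p : T * n.-tuple T) : n.+1.-tuple T :=
  [the n.+1.-tuple T of p.1 :: p.2].

Lemma measurable_tcons n : measurable_fun setT (@tcons n).
Proof. by apply: measurable_cons; [exact: measurable_fst|exact: measurable_snd]. Qed.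

Section Cons.
Context (n : nat) (m : {sigma_finite_measure set (n.-tuple T) -> \bar R}).

Definition cons_measure : set (n.+1.-tuple T) -> \bar R :=
  pushforward (mu \x m)%E (@tcons n).

Let cons_measure0 : cons_measure set0 = 0%E.
Proof. by rewrite /cons_measure /pushforward preimage_set0 measure0. Qed.

Let cons_measure_ge0 A : (0 <= cons_measure A)%E.
Proof. by rewrite /cons_measure /pushforward; exact: measure_ge0. Qed.

Let cons_measure_sigma_additive : semi_sigma_additive cons_measure.
Proof.
have mP A : measurable A -> measurable (@tcons n @^-1` A).
  by move=> mA; rewrite -[X in measurable X]setTI; exact: measurable_tcons.
move=> F mF tF mUF; rewrite /cons_measure /pushforward preimage_bigcup.
apply: measure_semi_sigma_additive.
- by move=> i; exact: mP.
- apply/trivIsetP => /= i j _ _ ij; rewrite -preimage_setI.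
  by move/trivIsetP : tF => /(_ _ _ _ _ ij) -> //; rewrite preimage_set0.
- by rewrite -preimage_bigcup; exact: mP.
Qed.

HB.instance Definition _ := isMeasure.Build _ _ _ cons_measure
  cons_measure0 cons_measure_ge0 cons_measure_sigma_additive.

Let cons_measure_sigma_finite : sigma_finite setT cons_measure.
Proof.
pose u (t : n.+1.-tuple T) : T * n.-tuple T := (thead t, [tuple of behead t]).
have mu_ : measurable_fun setT u.
  apply: measurable_fun_pair; last exact: measurable_behead.
  exact: measurable_tnth.
have uK : cancel (@tcons n) u.
  by case=> x t; rewrite /u theadE; congr pair; apply/val_inj.
have [F F_T F_oo] := sigma_finite_prod mu m.
exists (fun i => u @^-1` F i).
  by rewrite -preimage_bigcup -F_T preimage_setT.
move=> i; have [mFi Fioo] := F_oo i; split.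
  by rewrite -[X in measurable X]setTI; exact: mu_.
rewrite /cons_measure /pushforward -comp_preimage.
by rewrite (_ : u \o _ = id) //; apply/funext => p; exact: uK.
Qed.

HB.instance Definition _ := Measure_isSigmaFinite.Build _ _ _ cons_measure
  cons_measure_sigma_finite.
End Cons.

Fixpoint tuple_measure (n : nat) : {sigma_finite_measure set (n.-tuple T) -> \bar R} :=
  match n with
  | 0 => [the {sigma_finite_measure set (0.-tuple T) -> \bar R} of dirac [tuple]]
  | n'.+1 => [the {sigma_finite_measure set (n'.+1.-tuple T) -> \bar R} of
              cons_measure (tuple_measure n')]
  end.
End TupleMeasure.

(* C = R^2 as a measurable space; (u, v) stands for u + iv, and
   n.-tuple (plane R) for C^n. *)
Definition plane (R : realType) : Type := (measurableTypeR R * measurableTypeR R)%type.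

Section PlaneMeasure.
Context (R : realType).

HB.instance Definition _ := Measurable.copy (plane R)
  (measurableTypeR R * measurableTypeR R)%type.

Definition plane_measure : set (plane R) -> \bar R :=
  (@lebesgue_measure R \x @lebesgue_measure R)%E.

Let plane_measure0 : plane_measure set0 = 0%E.
Proof. by rewrite /plane_measure measure0. Qed.

Let plane_measure_ge0 A : (0 <= plane_measure A)%E.
Proof. by rewrite /plane_measure; exact: measure_ge0. Qed.

Let plane_measure_sigma_additive : semi_sigma_additive plane_measure.
Proof.
by move=> F mF tF mUF; rewrite /plane_measure; exact: measure_semi_sigma_additive.
Qed.

HB.instance Definition _ := isMeasure.Build _ _ _ plane_measure
  plane_measure0 plane_measure_ge0 plane_measure_sigma_additive.

Let plane_measure_sigma_finite : sigma_finite setT plane_measure.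
Proof. exact: sigma_finite_prod. Qed.

HB.instance Definition _ := Measure_isSigmaFinite.Build _ _ _ plane_measure
  plane_measure_sigma_finite.

Definition lebesgueC (n : nat) : {sigma_finite_measure set (n.-tuple (plane R)) -> \bar R} :=
  tuple_measure plane_measure n.
End PlaneMeasure.

Section Superfunctions.
Context (R : realType).
Local Notation C := R[i].

Definition toC (p : plane R) : C := (p.1 +i* p.2)%C.
Definition ofC (z : C) : plane R := (complex.Re z, complex.Im z).

(* The odd generators are the real and imaginary parts of the odd coordinates:
   (mu, false) is sigma^mu and (mu, true) is tau^mu, in the order
   sigma^1 < tau^1 < sigma^2 < tau^2 < ... *)
Definition odd_coords (m : nat) : finOrderType _ := ('I_m *l bool)%type.

(* Superfunctions on C^(n|m), expanded in sigma, tau; every operation below is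
   pointwise in the even coordinates, so no regularity is imposed here. *)
Definition superfunction (n m : nat) : Type :=
  n.-tuple (plane R) -> grassmann (odd_coords m) C.

Section Coordinates.
Context (n m : nat).
Local Notation G := (grassmann (odd_coords m) C).

Definition sigma (mu : 'I_m) : G := ggen C ((mu, false) : odd_coords m).
Definition tau (mu : 'I_m) : G := ggen C ((mu, true) : odd_coords m).
Definition theta (mu : 'I_m) : G := sigma mu + 'i%C *: tau mu.
Definition thetabar (mu : 'I_m) : G := sigma mu - 'i%C *: tau mu.

(* The integral with respect to [du,dv|dsigma,dtau].  The sign is the
   normalization for which exp(- 2 \sum_mu sigma^mu tau^mu), whose top
   coefficient is (-2)^m, has odd integral 2^m. *)
Definition odd_integral (f : superfunction n m) (w : n.-tuple (plane R)) : C :=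
  (-1) ^+ m * gtop (f w).

Definition berezin_integrable (f : superfunction n m) : Prop :=
  (lebesgueC R n).-integrable setT (fun w => (complex.Re (odd_integral f w))%:E) /\
  (lebesgueC R n).-integrable setT (fun w => (complex.Im (odd_integral f w))%:E).

Definition berezin_integral (f : superfunction n m) : C :=
  (Rintegral (lebesgueC R n) setT (fun w => complex.Re (odd_integral f w)) +i*
   Rintegral (lebesgueC R n) setT (fun w => complex.Im (odd_integral f w)))%C.

(* A Berezin volume element on C^(n|m) is represented by its coefficient with
   respect to [du,dv|dsigma,dtau].  [complex_volume] is the coefficient of
   [dw,dwbar|dtheta,dthetabar]: the Berezinian of the passage to complex
   coordinates, with n even blocks and m odd blocks equal to the matrix of
   (w, wbar) = (u + iv, u - iv). *)
Definition complex_volume : C :=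
  (\det (\matrix_(j < 2, k < 2) if k == ord0 then 1 else (-1) ^+ j * 'i%C)) ^ (n%:Z - m%:Z).

(* N = 1 + \sum_a w^a wbar^a + i \sum_mu theta^mu thetabar^mu. *)
Definition FS_N : superfunction n m := fun w =>
  1 + \sum_(a < n) (toC (tnth w a) * (toC (tnth w a))^*%C)%:A
    + 'i%C *: (\sum_(mu < m) theta mu * thetabar mu).

(* r^(2(n-m)) (i/2)^(n-m) [dw,dwbar|dtheta,dthetabar] / N^(n-m+1), where the
   exponents are integers, possibly negative. *)
Definition FS_volume (r : R) : superfunction n m := fun w =>
  ((r%:C%C ^ (2 * (n%:Z - m%:Z))) * (('i%C / 2) ^ (n%:Z - m%:Z)) * complex_volume) *:
  (FS_N w) ^ (- (n%:Z - m%:Z + 1)).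
End Coordinates.
End Superfunctions.

Section ProjectiveSuperspace.
Context (R : realType).
Local Notation C := R[i].

(* Homogeneous coordinates, with z^k = 1, of the point of CP^n whose
   inhomogeneous coordinates in the k-th affine chart are w. *)
Definition chart (n : nat) (k : 'I_n.+1) (w : n.-tuple (plane R)) : n.+1.-tuple (plane R) :=
  [tuple (if unlift k j is Some a then tnth w a else ofC 1) | j < n.+1].

Definition cscale (n : nat) (c : C) (z : n.-tuple (plane R)) : n.-tuple (plane R) :=
  [tuple ofC (c * toC (tnth z j)) | j < n].

(* Borel partitions of unity on CP^n subordinate to the affine cover, written as
   functions of the homogeneous coordinates; the smooth ones are a special case.
   The transition functions of CP^(n|m) are w^a / w^l and theta^mu / w^l: the even
   ones do not involve the odd coordinates, so functions of the even coordinates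
   are well defined on CP^(n|m), and odd integration in the charts gives complex
   densities on open sets of CP^n, for which Borel cut-offs are enough. *)
Record partition_of_unity (n : nat) (rho : 'I_n.+1 -> n.+1.-tuple (plane R) -> R) : Prop := {
  partition_measurable : forall k, measurable_fun setT (rho k);
  partition_ge0 : forall k z, 0 <= rho k z;
  partition_homogeneous : forall k (c : C) z, c != 0 -> rho k (cscale c z) = rho k z;
  partition_subordinate : forall k z, toC (tnth z k) = 0 -> rho k z = 0;
  partition_sum1 : forall z, (exists j, toC (tnth z j) != 0) -> \sum_k rho k z = 1
}.

Definition cutoff (n m : nat) (rho : 'I_n.+1 -> n.+1.-tuple (plane R) -> R)
    (dV : 'I_n.+1 -> superfunction R n m) (k : 'I_n.+1) : superfunction R n m :=
  fun w => (rho k (chart k w))%:C%C *: dV k w.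

(* v is the Berezin integral over CP^(n|m) of the volume element whose
   expression in the k-th affine chart is dV k: the sum of the integrals over the
   charts of the pieces rho_k dV is v, whatever the partition of unity. *)
Definition is_integral_CP (n m : nat) (dV : 'I_n.+1 -> superfunction R n m) (v : C) : Prop :=
  (exists rho, @partition_of_unity n rho) /\
  forall rho, @partition_of_unity n rho ->
    (forall k, berezin_integrable (cutoff rho dV k)) /\
    \sum_k berezin_integral (cutoff rho dV k) = v.

(* The volume element has the same expression in every affine chart, in terms of
   the inhomogeneous coordinates of that chart. *)
Definition is_volume_CP (n m : nat) (r : R) (v : C) : Prop :=
  is_integral_CP (fun _ : 'I_n.+1 => @FS_volume R n m r) v.

(* Euler's integral, meaningful for 0 < x. *)
Definition euler_Gamma (x : R) : R :=
  Rintegral (@lebesgue_measure R) `]0, +oo[ (fun t => t `^ (x - 1) * expR (- t)).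

(* 1 / Gamma, continued to all real x by
   1 / Gamma(x) = x (x+1) ... (x+k-1) / Gamma(x+k), with k such that x + k > 0;
   it vanishes at the poles 0, -1, -2, ... of Gamma. *)
Definition rGamma (x : R) : R :=
  let k := `|Num.floor x|%N.+1 in
  (\prod_(i < k) (x + i%:R)) / euler_Gamma (x + k%:R).
End ProjectiveSuperspace.

(* Main.v *)
(* The element N is s + 2 X, where s = 1 + |w|^2 and X = \sum_mu sigma^mu tau^mu is
   central and nilpotent, so the top coefficient of N^-(n-m+1) is
   (-2)^m (n-m+1) (n-m+2) ... n s^-(n+1), and the odd integration reduces the volume to
   that of CP^n.  For the latter, insert the homogeneous functions rho_k into the
   Gaussian integral pi^(n+1) over C^(n+1) and substitute z = t (1, w) in the k-th
   chart: as the integral of |t|^2n exp (- s |t|^2) over C is pi n! / s^(n+1), summing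
   over k gives \sum_k \int rho_k s^-(n+1) dw = pi^n / n!. *)
Require Import Defs.
From mathcomp Require Import all_boot all_order all_algebra.
From mathcomp Require Import ring zify.
Set Implicit Arguments.
Unset Strict Implicit.
Unset Printing Implicit Defensive.
Import Order.TTheory GRing.Theory Num.Theory.
Local Open Scope ring_scope.

(** * Powers of even elements of the Grassmann algebra *)

Section GrassmannMonomials.
Context (d : Order.disp_t) (I : finOrderType d) (K : comNzRingType).
Local Notation G := (grassmann I K).

(** The exponent [- (n - m + 1)] may have either sign, and a negative power presupposes a two-sided
    inverse in a noncommutative ring. Both points are settled by the finite binomial expansion [P p]
    of [N ^ p]: the relations [N * P p = P (p + 1)] and [P 0 = 1] give invertibility and all integer
    powers at once. On the analytic side, Tonelli reduces the substitution z = t (1, w) to affine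
    changes of one real variable. This asks for Re t != 0 rather than t != 0, so integrands are
    compared off a null set. All integrands are nonnegative and the integrals stay in the extended
    reals; the integrability of each chart's piece is read off at the end from the finite total. The
    planar moments pi n! and the values of Gamma at positive integers come from the same recursion,
    [moment_step]. Finally (n-m+1) ... n / n! is 1 / Gamma(n-m+1): it equals 1 / (n-m)! for m <= n,
    and for m > n one factor is zero while Gamma has a pole. *)

Definition gmono (S : {set I}) : G := [ffun A => (A == S)%:R].

Lemma gmono0 : gmono set0 = 1. Proof. by []. Qed.

Lemma gmonoM (S T : {set I}) : gmono S * gmono T = gsign K S T *: gmono (S :|: T).
Proof.
apply/ffunP => A; rewrite !ffunE (bigD1 S)//= [X in _ + X]big1 ?addr0; last first.
  by move=> B /negbTE BS; apply: big1 => C _; rewrite ffunE BS mul0r mulr0.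
rewrite big_mkcond (bigD1 T)//= [X in _ + X]big1 ?addr0; last first.
  by move=> C /negbTE CT; rewrite !ffunE CT !mulr0 if_same.
by rewrite !ffunE !eqxx mulr1 eq_sym; case: ifP; rewrite ?scaler1 ?scaler0.
Qed.
End GrassmannMonomials.

(** * Commuting products of the pairs sigma^mu tau^mu *)

Section PairMonomials.
Context (m : nat) (K : comNzRingType).
Local Notation I := (odd_coords m).
Local Notation G := (grassmann I K).

Implicit Types A B : {set 'I_m}.

(** In the lexicographic order sigma^mu and tau^mu are adjacent, so the monomial of [odd_pairs A] is
    the product of the sigma^mu tau^mu with mu in [A]. *)
Definition odd_pairs (A : {set 'I_m}) : {set I} := [set p : I | p.1 \in A].

Lemma odd_pairsU A B : odd_pairs (A :|: B) = odd_pairs A :|: odd_pairs B.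
Proof. by apply/setP => p; rewrite !inE. Qed.

Lemma disjoint_odd_pairs A B : [disjoint odd_pairs A & odd_pairs B] = [disjoint A & B].
Proof.
rewrite -!setI_eq0; apply/eqP/eqP => /setP AB; apply/setP.
  by move=> mu; have := AB ((mu, false) : I); rewrite !inE.
by move=> [mu b]; have := AB mu; rewrite !inE.
Qed.

(** By disjointness the first components differ, so a generator from [B] lies below both or neither
    of sigma^mu and tau^mu. Inversions thus come in twos, and products of pairs multiply without
    sign. *)
Lemma inversions_odd_pairs A B : [disjoint A & B] ->
  ~~ odd (inversions (odd_pairs A) (odd_pairs B)).
Proof.
move=> dAB.
pose f (p : I) := (\sum_(q in odd_pairs B) (q < p)%O)%N.
have -> : inversions (odd_pairs A) (odd_pairs B) = (\sum_(mu in A) (f (mu, false)).*2)%N.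
  rewrite /inversions (eq_bigr f)//.
  rewrite (eq_bigl (fun p : 'I_m * bool => (p.1 \in A) && true)); last first.
    by move=> p; rewrite inE andbT.
  rewrite -(pair_big_dep (fun mu => mu \in A) (fun _ _ => true) (fun mu b => f (mu, b))) /=.
  apply: eq_bigr => mu muA; rewrite big_bool /= -addnn; congr (_ + _)%N.
  apply: eq_bigr => q; rewrite inE => qB.
  have qmu : q.1 != mu by apply: contraTneq muA => <-; rewrite (disjointFl dAB).
  by rewrite !Order.ProdLexiOrder.ltEprodlexi/= !(le_eqVlt _ q.1) ![mu == _]eq_sym
    (negbTE qmu) /=; case: ltgtP qmu.
by elim/big_ind: _ => // [x y|mu _]; rewrite ?oddD ?odd_double// => /negbTE-> /negbTE->.
Qed.

Lemma gmono_odd_pairsM A B : gmono K (odd_pairs A) * gmono K (odd_pairs B) =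
  if [disjoint A & B] then gmono K (odd_pairs (A :|: B)) else 0.
Proof.
rewrite gmonoM /gsign disjoint_odd_pairs odd_pairsU; case: ifP => dAB; last by rewrite scale0r.
by rewrite -signr_odd (negbTE (inversions_odd_pairs dAB)) expr0 scale1r.
Qed.

(* The divided powers X^j / j! of X = pair_sum 1 = \sum_mu sigma^mu tau^mu. *)
Definition pair_sum (j : nat) : G := \sum_(A : {set 'I_m} | #|A| == j) gmono K (odd_pairs A).

Lemma pair_sum0 : pair_sum 0 = 1.
Proof.
rewrite /pair_sum (big_pred1 set0) => [|A]; last by rewrite cards_eq0.
by rewrite -gmono0; congr gmono; apply/setP => p; rewrite !inE.
Qed.

Lemma pair_sum_gt j : (m < j)%N -> pair_sum j = 0.
Proof.
move=> mj; apply: big_pred0 => A; apply/eqP => Aj.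
by have := max_card (mem A); rewrite card_ord Aj leqNgt mj.
Qed.

(** Each set [B] of size j+1 arises once for every [mu] in [B], from [B :\ mu]; a [mu] already in
    [A] contributes 0. In terms of powers, X (X^j / j!) = (j+1) X^(j+1) / (j+1)!. *)
Lemma pair_sumM1 j :
  (\sum_mu gmono K (odd_pairs [set mu])) * pair_sum j = j.+1%:R *: pair_sum j.+1.
Proof.
rewrite big_distrlr /=.
transitivity (\sum_(mu < m) \sum_(B : {set 'I_m} | (#|B| == j.+1) && (mu \in B))
    gmono K (odd_pairs B)).
  apply: eq_bigr => mu _.
  rewrite [RHS](reindex_onto (fun A => mu |: A) (fun B => B :\ mu)) => [|B /andP[_ muB]];
    last by rewrite setD1K.
  under eq_bigr do rewrite gmono_odd_pairsM disjoints1.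
  rewrite -big_mkcondr; apply: eq_bigl => A; rewrite setU11 andbT.
  have [muA|muA] := boolP (mu \in A).
    rewrite andbF; apply/esym/negbTE; rewrite negb_and; apply/orP; right.
    by apply: contraTneq muA => <-; rewrite !inE eqxx.
  by rewrite setU1K// eqxx !andbT cardsU1 muA add1n eqSS.
rewrite (exchange_big_dep (fun B : {set 'I_m} => #|B| == j.+1)) => [|mu B _ /andP[]//].
rewrite scaler_sumr; apply: eq_bigr => B /eqP Bj.
by rewrite /= Bj eqxx sumr_const Bj scaler_nat.
Qed.

Lemma pair_sum1 : pair_sum 1 = \sum_(mu < m) gmono K (odd_pairs [set mu]).
Proof. by have := pair_sumM1 0; rewrite pair_sum0 mulr1 scale1r => ->. Qed.

Lemma pair_sumC i j : pair_sum i * pair_sum j = pair_sum j * pair_sum i.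
Proof.
rewrite !big_distrlr /= exchange_big /=; apply: eq_bigr => A _; apply: eq_bigr => B _.
by rewrite !gmono_odd_pairsM disjoint_sym setUC.
Qed.

Lemma gtop_pair_sum j : (j <= m)%N -> gtop (pair_sum j) = (j == m)%:R.
Proof.
move=> jm; rewrite /gtop sum_ffunE.
have pT A : ([set: I] == odd_pairs A) = (A == setT).
  apply/eqP/eqP => [/setP AT|->]; apply/setP; last by move=> p; rewrite !inE.
  by move=> mu; have := AT (mu, false); rewrite !inE.
under eq_bigr do rewrite ffunE pT.
have [jm'|jm'] := eqVneq j m.
  rewrite (bigD1 setT) ?cardsT ?card_ord ?jm'//= eqxx big1 ?addr0// => A /andP[_ /negbTE->]//.
apply: big1 => A /eqP Aj; case: eqP => // AT.
by rewrite -Aj AT cardsT card_ord eqxx in jm'.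
Qed.
End PairMonomials.

(** * Integer powers of s + c X by a finite binomial series *)

Section PairPower.
Context (m : nat) (K : fieldType) (s c : K).
Hypothesis s0 : s != 0.
Local Notation G := (grassmann (odd_coords m) K).

(** The falling factorial p (p-1) ... (p-j+1), that is j! times the generalized binomial
    coefficient, for [p] of any sign. *)
Definition zfalling (p : int) (j : nat) : int := \prod_(i < j) (p - i%:Z).

Lemma zfallingS p j : zfalling p j.+1 = zfalling p j * (p - j%:Z).
Proof. by rewrite /zfalling big_ord_recr. Qed.

Lemma zfalling1S p j : zfalling (p + 1) j.+1 = (p + 1) * zfalling p j.
Proof.
rewrite /zfalling big_ord_recl /= subr0; congr (_ * _); apply: eq_bigr => i _.
by rewrite /bump /= PoszD; ring.
Qed.

Let N : G := s%:A + c *: pair_sum m K 1.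

Let coef (p : int) (j : nat) : K := (zfalling p j)%:~R * c ^+ j * s ^ (p - j%:Z).

(** The binomial series of (s + c X)^p, which stops at X^m. The divided powers absorb the j!, so no
    characteristic is excluded. *)
Let P (p : int) : G := \sum_(j < m.+1) coef p j *: pair_sum m K j.

(** Pascal's rule multiplied by (j+1)!: writing (p)_j for falling factorials, (p+1)_(j+1) =
    (p)_(j+1) + (j+1) (p)_j. *)
Let coef_rec p j : s * coef p j.+1 + c * coef p j * j.+1%:R = coef (p + 1) j.+1.
Proof.
rewrite /coef zfallingS zfalling1S.
have -> : p + 1 - j.+1%:Z = p - j%:Z by rewrite intS; ring.
have <- : s * s ^ (p - j.+1%:Z) = s ^ (p - j%:Z).
  by rewrite -{1}(expr1z s) -expfzDr// intS; congr (_ ^ _); ring.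
by rewrite !intrM intrB intrD exprS -natr1; ring.
Qed.

Let mulNP p : N * P p = P (p + 1).
Proof.
rewrite mulrDl -scalerAl mul1r -scalerAl /P mulr_sumr scaler_sumr scaler_sumr.
under [X in _ + X]eq_bigr do rewrite -scalerAr [pair_sum m K 1]pair_sum1 pair_sumM1 !scalerA.
(* The last term of the product by X carries X^(m+1) = 0. *)
rewrite [X in _ + X]big_ord_recr /= (pair_sum_gt K (ltnSn m)) scaler0 addr0.
rewrite big_ord_recl [RHS]big_ord_recl -addrA -big_split /=; congr (_ + _).
  rewrite scalerA; congr (_ *: _); rewrite /coef /zfalling !big_ord0 !subr0 !mul1r.
  by rewrite addrC expfzDr// expr1z.
by apply: eq_bigr => j _; rewrite /bump /= add1n scalerA -scalerDl coef_rec.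
Qed.

Let P0 : P 0 = 1.
Proof.
rewrite /P big_ord_recl pair_sum0 big1 ?addr0 => [|j _].
  by rewrite /coef /zfalling big_ord0 subr0 expr0z !mul1r scale1r.
have := zfalling1S (-1) j; rewrite addNr mul0r /coef lift0 => ->.
by rewrite !mul0r scale0r.
Qed.

(** Both factors are combinations of the commuting [pair_sum j]; this makes the inverse [P (-1)]
    two-sided. *)
Let commNP p : N * P p = P p * N.
Proof.
rewrite mulrDl mulrDr -!scalerAl -!scalerAr mul1r mulr1; congr (_ + _ *: _).
rewrite mulr_sumr mulr_suml; apply: eq_bigr => j _.
by rewrite -scalerAl -scalerAr pair_sumC.
Qed.

Lemma pair_power_unit : N \is a GRing.unit.
Proof.
apply/unitrP; exists (P (-1)).
by rewrite -commNP mulNP addNr P0.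
Qed.

(** Iterating the shift from [P 0 = 1] gives the powers with p >= 0; for p < 0 both sides are
    inverse to the same [N ^+ k.+1]. *)
Lemma pair_powerE p : N ^ p = P p.
Proof.
have NP k q : N ^+ k * P q = P (q + k%:Z).
  elim: k q => [|k IHk] q; first by rewrite mul1r addr0.
  rewrite exprS -mulrA IHk mulNP; congr P; rewrite intS; ring.
case: p => k.
  by rewrite -exprnP -[LHS]mulr1 -P0 NP add0r.
rewrite NegzE -exprnN; apply: (mulrI (unitrX k.+1 pair_power_unit)).
by rewrite NP addNr P0 divrr ?unitrX ?pair_power_unit.
Qed.

(** Only j = m reaches the top monomial. At p = -(n-m+1) the exponent p - m is -(n+1), so the
    dependence on the even coordinates no longer involves m. *)
Lemma gtop_pair_power p :
  gtop (N ^ p) = (zfalling p m)%:~R * c ^+ m * s ^ (p - m%:Z).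
Proof.
rewrite pair_powerE /P /gtop sum_ffunE big_ord_recr /= big1 ?add0r => [|j _].
  by rewrite ffunE -/(gtop (pair_sum m K m)) gtop_pair_sum// eqxx /GRing.scale /= mulr1.
by rewrite ffunE -/(gtop (pair_sum m K j)) gtop_pair_sum 1?ltnW// ltn_eqF// /GRing.scale /= mulr0.
Qed.
End PairPower.

From mathcomp Require Import complex.
From mathcomp Require Import all_classical all_reals all_analysis measurable_realfun.
Import numFieldNormedType.Exports.
Local Open Scope classical_set_scope.
Local Open Scope ring_scope.

(** * Integration over C^n *)

Section AffineChange.
Context {R : realType}.
Local Notation leb := (@lebesgue_measure R).

Let affine (a b : R) : measurableTypeR R -> measurableTypeR R := fun x => a * x + b.

Let measurable_affine a b : measurable_fun setT (affine a b).
Proof. by apply: measurable_funD => //; apply: measurable_funM. Qed.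

Let affine_measure a b : {measure set (measurableTypeR R) -> \bar R} :=
  mscale `|a|%:nng (measure_function_pushforward__canonical__measure_function_Measure
    leb (measurable_affine a b)).

(** Half-open intervals determine the measure. For a < 0 the preimage of such an interval is closed
    at the other end, with the same length. *)
Lemma lebesgue_measure_affine (a b : R) (A : set (measurableTypeR R)) :
  a != 0 -> measurable A ->
  (leb A = `|a|%R%:E * leb ((fun x => (a * x + b)%R) @^-1` A))%E.
Proof.
move=> a0 mA.
suff : leb A = affine_measure a b A by [].
apply: lebesgue_measure_unique => // _ [[x y] _ <-].
change (leb `]x, y] = (`|a|%R%:E * leb (affine a b @^-1` `]x, y]))%E).
have [a_lt0|a_gt0|] := ltrgtP a 0; last by move/eqP; rewrite (negbTE a0).
  rewrite (_ : _ @^-1` _ = `[((y - b) / a), ((x - b) / a)[%classic); last first.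
    apply/seteqP; split=> u /=;
    by rewrite /affine !in_itv /= ler_ndivrMr // ltr_ndivlMr // lerBrDr ltrBlDr mulrC andbC.
  rewrite !lebesgue_measure_itv/= !lte_fin ltr_nM2r ?invr_lt0// ltrD2r.
  case: ifP => _; last by rewrite mule0.
  by rewrite -!EFinB -EFinM ltr0_norm//; congr EFin; field.
rewrite (_ : _ @^-1` _ = `](x - b) / a, (y - b) / a]%classic); last first.
  apply/seteqP; split=> u /=;
  by rewrite /affine !in_itv /= ler_pdivlMr // ltr_pdivrMr // lerBrDr ltrBlDr mulrC.
rewrite !lebesgue_measure_itv/= !lte_fin ltr_pM2r ?invr_gt0// ltrD2r.
case: ifP => _; last by rewrite mule0.
by rewrite -!EFinB -EFinM gtr0_norm//; congr EFin; field.
Qed.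

Lemma integral_affine (a b : R) (f : R -> \bar R) : a != 0 ->
  measurable_fun setT f -> (forall x, 0 <= f x)%E ->
  (\int[leb]_x f x = `|a|%R%:E * \int[leb]_x f (a * x + b)%R)%E.
Proof.
move=> a0 mf f0.
transitivity (\int[affine_measure a b]_x f x)%E.
  by apply: eq_measure_integral => //= A mA _; apply: lebesgue_measure_affine.
rewrite ge0_integral_mscale//; congr (_ * _)%E.
by exact: (ge0_integral_pushforward (measurable_affine a b) leb measurableT mf).
Qed.
End AffineChange.

(** * Multiplication by a complex number in the plane *)

Section Plane.
Context {R : realType}.
Local Notation leb := (@lebesgue_measure R).
Local Notation C := R[i].
Local Notation mu := (@plane_measure R).

Definition sqnorm (p : plane R) : R := p.1 ^+ 2 + p.2 ^+ 2.

Lemma sqnorm_ge0 p : 0 <= sqnorm p.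
Proof. by rewrite addr_ge0 ?sqr_ge0. Qed.

Lemma measurable_sqnorm : measurable_fun setT sqnorm.
Proof. by apply: measurable_funD; exact: measurable_funX. Qed.

Lemma ofC_mul_toC (c : C) (p : plane R) : ofC (c * toC p) =
  (complex.Re c * p.1 - complex.Im c * p.2, complex.Re c * p.2 + complex.Im c * p.1).
Proof. by case: c => a b. Qed.

Lemma sqnorm_mul (c : C) p : sqnorm (ofC (c * toC p)) = sqnorm (ofC c) * sqnorm p.
Proof. by rewrite ofC_mul_toC /sqnorm /=; ring. Qed.

Lemma measurable_ofC_mul d (T : measurableType d) (f g : T -> plane R) :
  measurable_fun setT f -> measurable_fun setT g ->
  measurable_fun setT (fun x => ofC (toC (f x) * toC (g x)) : plane R).
Proof.
move=> mf mg.
have m1 (h : T -> plane R) : measurable_fun setT h -> measurable_fun setT (fun x => (h x).1).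
  by move=> mh; apply: measurableT_comp mh; exact: measurable_fst.
have m2 (h : T -> plane R) : measurable_fun setT h -> measurable_fun setT (fun x => (h x).2).
  by move=> mh; apply: measurableT_comp mh; exact: measurable_snd.
rewrite (_ : (fun x => _) = (fun x => ((f x).1 * (g x).1 - (f x).2 * (g x).2,
   (f x).1 * (g x).2 + (f x).2 * (g x).1))); last first.
  by apply/funext => x; rewrite ofC_mul_toC.
apply: measurable_fun_pair.
  by apply: measurable_funB; apply: measurable_funM; [exact: m1|exact: m1|exact: m2|exact: m2].
by apply: measurable_funD; apply: measurable_funM; [exact: m1|exact: m2|exact: m2|exact: m1].
Qed.

Lemma integral_planeE (f : plane R -> \bar R) :
  measurable_fun setT f -> (forall p, 0 <= f p)%E ->
  (\int[mu]_p f p = \int[leb]_u \int[leb]_v f (u, v))%E.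
Proof. by move=> mf f0; exact: (fubini_tonelli1 (m1 := leb) (m2 := leb)). Qed.

(* Multiplication by a + ib is the shear y = ((a^2+b^2)/a) v + (b/a) x followed by
   x = a u - b v; each is affine in one real variable. *)
Lemma integral_plane_mul (c : C) (f : plane R -> \bar R) : complex.Re c != 0 ->
  measurable_fun setT f -> (forall p, 0 <= f p)%E ->
  (\int[mu]_p f p =
   (sqnorm (ofC c))%:E * \int[mu]_p f (ofC (c * toC p)%R))%E.
Proof.
case: c => a b /= a0 mf f0.
have mfst := @measurable_fst _ _ (measurableTypeR R) (measurableTypeR R).
have msnd := @measurable_snd _ _ (measurableTypeR R) (measurableTypeR R).
have mg : measurable_fun setT (fun p : plane R => f (ofC ((a +i* b)%C * toC p))).
  apply: measurableT_comp mf _.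
  apply: (measurable_ofC_mul (f := fun=> (a, b) : plane R)) => //.
rewrite !integral_planeE//.
pose k := (a ^+ 2 + b ^+ 2) / a.
have ab0 : 0 < a ^+ 2 + b ^+ 2 by rewrite ltr_wpDr ?sqr_ge0// exprn_even_gt0.
have k0 : k != 0 by rewrite mulf_neq0 ?invr_eq0// gt_eqF.
have mh : measurable_fun setT (fun p : plane R => f (p.1, k * p.2 + b / a * p.1)).
  apply: measurableT_comp mf _; apply: measurable_fun_pair => //.
  by apply: measurable_funD; apply: measurable_funM.
transitivity (\int[leb]_x (`|k|%R%:E * \int[leb]_v f (x, (k * v + b / a * x)%R)))%E.
  apply: eq_integral => x _; apply: (integral_affine (b / a * x) k0) => //.
  exact: (measurableT_comp mf).
rewrite ge0_integralZl; last 4 first.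
- exact: measurableT.
- exact: (measurable_fun_fubini_tonelli_F (m2 := leb) _ mh (fun=> f0 _)).
- by move=> x _; apply: integral_ge0 => v _; exact: f0.
- by rewrite lee_fin.
rewrite (fubini_tonelli (m1 := leb) (m2 := leb) _ mh (fun=> f0 _)) /=.
rewrite (fubini_tonelli (m1 := leb) (m2 := leb) _ mg (fun=> f0 _)) /=.
rewrite (_ : sqnorm _ = `|k| * `|a|)%R; last first.
  by rewrite -normrM /k divfK// ger0_norm ?(ltW ab0).
rewrite EFinM -muleA; congr (_ * _)%E.
rewrite -ge0_integralZl; last 4 first.
- exact: measurableT.
- exact: (measurable_fun_fubini_tonelli_G (m1 := leb) _ mg (fun=> f0 _)).
- by move=> v _; apply: integral_ge0 => u _; exact: f0.
- by rewrite lee_fin.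
apply: eq_integral => v _.
rewrite (integral_affine (- (b * v)) a0)//; last exact: (measurableT_comp mh (pair2_measurable v)).
congr (_ * _)%E; apply: eq_integral => u _; congr (f _).
by rewrite ofC_mul_toC /=; congr pair; rewrite /k; field.
Qed.

(** The shear behind [integral_plane_mul] divides by the real part of the multiplier, so multipliers
    on the imaginary axis are discarded as a null set. *)
Lemma ae_plane_neq0 : {ae mu, forall p : plane R, p.1 != 0}.
Proof.
exists ([set 0] `*` setT); split => //.
- exact: measurableX.
- rewrite [LHS](product_measure1E leb leb)//.
  by rewrite [X in (X * _)%E](_ : _ = 0%E) ?mul0e//; exact: lebesgue_measure_set1.
- by move=> [u v] /= /negP; rewrite negbK => /eqP.
Qed.
End Plane.

(** * Coordinates and scalings in C^n *)

Section TupleIntegral.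
Context {R : realType}.
Local Notation C := R[i].
Local Notation mu := (@plane_measure R).
Local Notation cat1 t w := ([the _.+1.-tuple (plane R) of t :: w]).

Lemma integral_lebesgueC0 (f : 0.-tuple (plane R) -> \bar R) :
  measurable_fun setT f -> (\int[lebesgueC R 0]_z f z = f [tuple])%E.
Proof.
move=> mf; rewrite /lebesgueC /= [LHS]integral_dirac//.
by rewrite diracT mul1e.
Qed.

Lemma integral_lebesgueCS n (f : n.+1.-tuple (plane R) -> \bar R) :
  measurable_fun setT f -> (forall z, 0 <= f z)%E ->
  (\int[lebesgueC R n.+1]_z f z =
   \int[mu]_t \int[lebesgueC R n]_w f (cat1 t w))%E.
Proof.
move=> mf f0.
have mcons := @measurable_tcons _ (plane R) n.
transitivity (\int[mu \x lebesgueC R n]_p f (tcons p))%E.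
  exact: (ge0_integral_pushforward mcons (mu \x lebesgueC R n)%E measurableT mf).
have mfc : measurable_fun setT (f \o @tcons _ (plane R) n) by exact: measurableT_comp.
exact: (fubini_tonelli1 (m1 := mu) (m2 := lebesgueC R n) _ mfc (fun=> f0 _)).
Qed.

(** The map [chart k] is the case where the inserted entry is 1; letting that entry vary turns chart
    coordinates into homogeneous ones. *)
Definition tinsert n (k : 'I_n.+1) (t : plane R) (w : n.-tuple (plane R)) :=
  [tuple (if unlift k j is Some a then tnth w a else t) | j < n.+1].

Lemma tinsert0 n t (w : n.-tuple (plane R)) : tinsert ord0 t w = cat1 t w.
Proof.
apply: eq_from_tnth => j; rewrite tnth_mktuple.
by case: unliftP => [a|] ->; rewrite ?tnthS.
Qed.

Lemma tinsertS n (k : 'I_n.+1) s t (w : n.-tuple (plane R)) :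
  tinsert (lift ord0 k) t (cat1 s w) = cat1 s (tinsert k t w).
Proof.
have lift0S (a : 'I_n) : lift ord0 (lift k a) = lift (lift ord0 k) (lift ord0 a).
  by apply: val_inj; rewrite /= /bump /= !add1n addnS ltnS.
apply: eq_from_tnth => j; rewrite tnth_mktuple.
have [j' ->|->] := unliftP ord0 j; last first.
  rewrite (_ : ord0 = lift (lift ord0 k) ord0) ?liftK ?tnth0//.
  exact: val_inj.
rewrite tnthS tnth_mktuple; have [a ->|->] := unliftP k j'.
  by rewrite lift0S liftK tnthS.
by rewrite unlift_none.
Qed.

Lemma measurable_tinsert n (k : 'I_n.+1) :
  measurable_fun setT (fun p : plane R * n.-tuple (plane R) => tinsert k p.1 p.2).
Proof.
apply/measurable_fun_tnthP => j.
rewrite (_ : _ \o _ = fun p => if unlift k j is Some a then tnth p.2 a else p.1).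
  case: unlift => [a|]; last exact: measurable_fst.
  by apply: (measurableT_comp (measurable_tnth a)); exact: measurable_snd.
by apply/funext => p /=; rewrite tnth_mktuple.
Qed.

(** The measure [lebesgueC] is built by consing and so singles out coordinate 0. By induction on
    [n], Tonelli carries coordinate [k] past the leading one to the outermost place. *)
Lemma integral_tinsert n (k : 'I_n.+1) (f : n.+1.-tuple (plane R) -> \bar R) :
  measurable_fun setT f -> (forall z, 0 <= f z)%E ->
  (\int[lebesgueC R n.+1]_z f z =
   \int[mu]_t \int[lebesgueC R n]_w f (tinsert k t w))%E.
Proof.
elim: n => [|n IHn] in k f * => mf f0.
  rewrite (integral_lebesgueCS mf f0); apply: eq_integral => t _.
  by apply: eq_integral => w _; rewrite ord1 tinsert0.
have [k' ->|->] := unliftP ord0 k; last first.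
  rewrite (integral_lebesgueCS mf f0); apply: eq_integral => t _.
  by apply: eq_integral => w _; rewrite tinsert0.
have mg (p : plane R) : measurable_fun setT (fun w : n.+1.-tuple (plane R) => f (cat1 p w)).
  by apply: measurableT_comp mf _; exact: measurable_cons.
have mh : measurable_fun setT (fun x : (plane R * plane R) * n.-tuple (plane R) =>
    f (cat1 x.1.1 (tinsert k' x.1.2 x.2))).
  apply: measurableT_comp mf _; apply: measurable_cons => /=.
    exact: (measurableT_comp measurable_fst measurable_fst).
  apply: (measurableT_comp (measurable_tinsert k')
    (g := fun x : (plane R * plane R) * n.-tuple (plane R) => (x.1.2, x.2))).
  apply: measurable_fun_pair => //.
  exact: (measurableT_comp measurable_snd measurable_fst).
have mH := measurable_fun_fubini_tonelli_F (m2 := lebesgueC R n) _ mh (fun=> f0 _).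
rewrite (integral_lebesgueCS mf f0).
transitivity (\int[mu]_s \int[mu]_t \int[lebesgueC R n]_w f (cat1 s (tinsert k' t w)))%E.
  by apply: eq_integral => s _; rewrite (IHn k' _ (mg s) (fun=> f0 _)).
rewrite (fubini_tonelli (m1 := mu) (m2 := mu) _ mH) /=; last first.
  by move=> x; apply: integral_ge0 => w _; exact: f0.
have mt t : measurable_fun setT (fun z => f (tinsert (lift ord0 k') t z)).
  apply: measurableT_comp mf _.
  exact: (measurableT_comp (measurable_tinsert (lift ord0 k')) (pair1_measurable t)).
apply: eq_integral => t _; rewrite (integral_lebesgueCS (mt t) (fun=> f0 _)).
by apply: eq_integral => s _; apply: eq_integral => w _; rewrite tinsertS.
Qed.

Lemma measurable_cscale n :
  measurable_fun setT (fun p : plane R * n.-tuple (plane R) => Defs.cscale (toC p.1) p.2).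
Proof.
apply/measurable_fun_tnthP => j.
rewrite (_ : _ \o _ = fun p => ofC (toC p.1 * toC (tnth p.2 j))).
  apply: measurable_ofC_mul; first exact: measurable_fst.
  by apply: (measurableT_comp (measurable_tnth j)); exact: measurable_snd.
by apply/funext => p /=; rewrite tnth_mktuple.
Qed.

(** Each complex coordinate contributes the real Jacobian |c|^2, by [integral_plane_mul] applied to
    one coordinate at a time. *)
Lemma integral_cscale n (c : C) (f : n.-tuple (plane R) -> \bar R) :
  complex.Re c != 0 -> measurable_fun setT f -> (forall z, 0 <= f z)%E ->
  (\int[lebesgueC R n]_w f w =
   (sqnorm (ofC c) ^+ n)%:E * \int[lebesgueC R n]_w f (Defs.cscale c w))%E.
Proof.
move=> c0.
have mc k : measurable_fun setT (fun w : k.-tuple (plane R) => Defs.cscale c w).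
  rewrite (_ : c = toC (ofC c)); last by case: (c).
  exact: (measurableT_comp (@measurable_cscale k) (pair1_measurable (ofC c))).
elim: n => [|n IHn] in f * => mf f0.
  rewrite expr0 mul1e; apply: eq_integral => w _; congr (f _).
  by apply: eq_from_tnth; case.
have m1 : measurable_fun setT (fun p : plane R * n.-tuple (plane R) =>
    f (cat1 p.1 (Defs.cscale c p.2))).
  apply: measurableT_comp mf _; apply: measurable_cons => //.
  exact: (measurableT_comp (mc n)).
have mF := measurable_fun_fubini_tonelli_F (m2 := lebesgueC R n) _ m1 (fun=> f0 _).
have catE t (w : n.-tuple (plane R)) :
    Defs.cscale c (cat1 t w) = cat1 (ofC (c * toC t)) (Defs.cscale c w).
  apply: eq_from_tnth => j; rewrite tnth_mktuple.
  by have [j' ->|->] := unliftP ord0 j; rewrite ?tnth0 ?tnthS ?tnth_mktuple.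
rewrite (integral_lebesgueCS mf f0).
rewrite (integral_lebesgueCS (measurableT_comp mf (mc n.+1)) (fun=> f0 _)).
transitivity (\int[mu]_t ((sqnorm (ofC c) ^+ n)%:E *
    \int[lebesgueC R n]_w f (cat1 t (Defs.cscale c w))))%E.
  apply: eq_integral => t _.
  rewrite (IHn (fun w : n.-tuple (plane R) => f (cat1 t w)) _ (fun=> f0 _))//.
  by apply: measurableT_comp mf _; exact: measurable_cons.
have c_ge0 : 0 <= sqnorm (ofC c) ^+ n by rewrite exprn_ge0// sqnorm_ge0.
have F0 t : (0 <= \int[lebesgueC R n]_w f (cat1 t (Defs.cscale c w)))%E.
  by apply: integral_ge0 => w _; exact: f0.
rewrite (ge0_integralZl mu measurableT mF (fun t _ => F0 t)); last by rewrite lee_fin.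
rewrite exprSr EFinM -muleA; congr (_ * _)%E.
rewrite (integral_plane_mul c0 mF F0).
congr (_ * _)%E; apply: eq_integral => t _; apply: eq_integral => w _.
by rewrite /= catE.
Qed.
End TupleIntegral.

(** * Gaussian moments and the Gamma function *)

Section RealIntegrals.
Context {R : realType}.
Local Notation leb := (@lebesgue_measure R).

Lemma ge0_integral_is_derive_y (f F : R -> R) (a l : R) :
  (forall x, a <= x -> 0 <= f x) ->
  (forall x, a <= x -> {for x, continuous f}) ->
  (forall x, a <= x -> is_derive x 1 F (f x)) ->
  F x @[x --> +oo] --> l ->
  (\int[leb]_(x in `[a, +oo[) (f x)%:E = (l - F a)%:E)%E.
Proof.
move=> f0 cf dF Fl; rewrite (ge0_continuous_FTC2y f0 _ Fl)//.
- by apply: continuous_in_subspaceT => x; rewrite inE/= in_itv/= andbT => /cf.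
- by move=> x /ltW/dF[].
- apply: cvg_at_right_filter.
  by have [/derivable1_diffP/differentiable_continuous] := dF a (lexx a).
- by move=> x; rewrite in_itv/= andbT derive1E => /ltW/dF[].
Qed.

(** The antiderivative is - exp (- s q). The case a = 1 represents exp (- q) in [moment_step]; the
    case a = 0 starts the recursion for Gamma. *)
Lemma integral_expRN (a q : R) : 0 < q ->
  (\int[leb]_(s in `[a, +oo[) (q * expR (- (s * q)))%:E = (expR (- (a * q)))%:E)%E.
Proof.
move=> q0.
have dF (s : R) : is_derive s 1 (fun s => - expR (- (s * q))) (q * expR (- (s * q))).
  rewrite -[fun _ => _]/(- (expR \o (- (fun s => s * q)))).
  by apply: is_derive_eq; rewrite /= !fctE /GRing.scale /=; ring.
have dF1 (s : R) : derivable (fun s : R => expR (- (s * q))) s 1.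
  rewrite -[fun _ => _]/(expR \o (- (fun s => s * q))).
  exact: ex_derive.
rewrite (@ge0_integral_is_derive_y _ (fun s => - expR (- (s * q))) a 0)//.
- by rewrite sub0r opprK.
- by move=> s _; rewrite mulr_ge0 ?expR_ge0// ltW.
- move=> s _; apply: cvgM; first exact: cvg_cst.
  by have /derivable1_diffP/differentiable_continuous := dF1 s.
- rewrite -oppr0; apply: cvgN.
  apply: (@cvg_comp _ _ _ (fun s => s * q) (fun s => expR (- s)) _ +oo); last exact: cvgr_expR.
  exact: gt0_cvgMly.
Qed.

Lemma integral_invX (n : nat) :
  (\int[leb]_(s in `[1%R, +oo[) (s^-1 ^+ n.+2)%:E = (n.+1%:R^-1)%:E)%E.
Proof.
have neq0 (s : R) : 1 <= s -> s != 0 by move=> s1; rewrite gt_eqF// (lt_le_trans ltr01).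
have dV (s : R) : 1 <= s -> is_derive s 1 (fun s : R => s^-1) (- s ^- 2).
  move=> /neq0 s0.
  by apply: is_derive_eq (is_deriveV s0 (is_derive_id s 1)) _; rewrite /GRing.scale /= mulr1.
have cX (m : nat) (s : R) : 1 <= s -> {for s, continuous (fun s : R => s^-1 ^+ m)}.
  move=> /neq0 s0; apply: (@cvg_comp _ _ _ (fun s : R => s^-1) (fun x => x ^+ m)).
    exact: inv_continuous.
  exact: exprn_continuous.
have dF (s : R) : 1 <= s ->
    is_derive s 1 (fun s : R => - n.+1%:R^-1 * s^-1 ^+ n.+1) (s^-1 ^+ n.+2).
  move=> s1; have ds := dV s s1.
  rewrite (_ : (fun _ => _) = - n.+1%:R^-1 *: (fun s : R => s^-1) ^+ n.+1); last first.
    by apply/funext => x; rewrite !fctE.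
  apply: is_derive_eq; rewrite /GRing.scale /= -!exprVn !exprS expr0 /=.
  have n0 : n.+1%:R != 0 :> R by rewrite pnatr_eq0.
  transitivity (n.+1%:R^-1 * n.+1%:R * (s^-1 * (s^-1 * s^-1 ^+ n))); first by ring.
  by rewrite mulVf// mul1r.
rewrite (@ge0_integral_is_derive_y _ (fun s : R => - n.+1%:R^-1 * s^-1 ^+ n.+1) 1 0 _ _ dF)//.
- by rewrite invr1 expr1n mulr1 sub0r opprK.
- by move=> s s1; rewrite exprn_ge0// invr_ge0 (le_trans ler01).
- by move=> s /cX.
- rewrite -[X in _ --> X](mulr0 (- n.+1%:R^-1)); apply: cvgM; first exact: cvg_cst.
  rewrite -[X in _ --> X](expr0n R n.+1).
  apply: (@cvg_comp _ _ _ (fun s : R => s^-1) (fun x => x ^+ n.+1)); last exact: exprn_continuous.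
  apply/gtr0_cvgV0; last exact: cvg_id.
  exact: nbhs_pinfty_gt.
Qed.
End RealIntegrals.

Section Moments.
Context {R : realType}.
Local Notation leb := (@lebesgue_measure R).
Local Open Scope ereal_scope.

(* Integrate e^-q = \int_1^oo q e^-sq ds against h q^n and exchange the integrals;
   the weight h restricts to q > 0, where this identity holds. *)
Lemma moment_step d (T : measurableType d) (mu : {sigma_finite_measure set T -> \bar R})
    (h q : T -> R) (n : nat) (c : \bar R) :
  measurable_fun setT h -> measurable_fun setT q ->
  (forall x, (0 <= h x)%R) -> (forall x, h x != 0%R -> (0 < q x)%R) ->
  0 <= c ->
  (forall s, (1 <= s)%R ->
    \int[mu]_x (h x * q x ^+ n.+1 * expR (- (s * q x)))%:E = c * (s^-1 ^+ n.+2)%:E) ->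
  \int[mu]_x (h x * q x ^+ n * expR (- q x))%:E = c * (n.+1%:R^-1)%:E.
Proof.
move=> mh mq h0 q0 c0 Hc.
pose D : set R := `[1%R, +oo[%classic.
have mD : measurable D by exact: measurable_itv.
pose g (p : T * R) : \bar R := (h p.1 * q p.1 ^+ n.+1 * expR (- (p.2 * q p.1)) * \1_D p.2)%:E.
have g0 p : 0 <= g p.
  rewrite lee_fin mulr_ge0// mulr_ge0 ?expR_ge0//.
  have [->|/q0/ltW qp] := eqVneq (h p.1) 0%R; first by rewrite mul0r.
  by rewrite mulr_ge0// exprn_ge0.
have mg : measurable_fun setT g.
  apply/measurable_EFinP; apply: measurable_funM; last first.
    exact: (measurableT_comp (f := \1_D : R -> R) (measurable_indic mD) measurable_snd).
  have mq1 : measurable_fun setT (fun p : T * R => q p.1) by exact: measurableT_comp.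
  apply: measurable_funM; first apply: measurable_funM.
  - exact: measurableT_comp.
  - exact: measurable_funX.
  - apply: measurableT_comp => //; apply: measurableT_comp => //.
    exact: measurable_funM.
transitivity (\int[mu]_x \int[leb]_s g (x, s)).
  apply: eq_integral => x _; rewrite /g /=.
  transitivity (\int[leb]_(s in D) (h x * q x ^+ n.+1 * expR (- (s * q x)))%:E); last first.
    by rewrite integral_mkcond epatch_indic.
  have [hx0|/q0 qx] := eqVneq (h x) 0%R.
    rewrite hx0 !mul0r; apply/esym/integral0_eq => s _; rewrite !mul0r//.
  under eq_integral do rewrite exprSr mulrA -mulrA EFinM.
  rewrite ge0_integralZl//; last 3 first.
  - apply/measurable_EFinP; apply: measurable_funTS.
    apply: measurable_funM => //; apply: measurableT_comp => //; apply: measurableT_comp => //.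
    exact: measurable_funM.
  - by move=> s _; rewrite lee_fin mulr_ge0 ?expR_ge0// ltW.
  - by rewrite lee_fin mulr_ge0// exprn_ge0// ltW.
  by rewrite integral_expRN// mul1r -EFinM.
rewrite (fubini_tonelli (m1 := mu) (m2 := leb) _ mg)//.
transitivity (\int[leb]_(s in D) (c * (s^-1 ^+ n.+2)%:E)).
  rewrite [RHS]integral_mkcond; apply: eq_integral => s _.
  rewrite epatch_indic /= /g /=; have [sD|sD] := boolP (s \in D).
    rewrite indicE sD mule1 -Hc//; last by move: sD; rewrite inE /D/= in_itv/= andbT.
    by apply: eq_integral => x _; rewrite mulr1.
  rewrite indicE (negbTE sD) mule0; apply: integral0_eq => x _.
  by rewrite mulr0.
rewrite ge0_integralZl//; last 2 first.
- apply/measurable_EFinP; apply: measurable_funX.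
  apply: subspace_continuous_measurable_fun => //.
  apply: continuous_in_subspaceT => s; rewrite inE /D/= in_itv/= andbT => s1.
  by apply: inv_continuous; rewrite gt_eqF// (lt_le_trans ltr01).
- move=> s; rewrite /D /= in_itv/= andbT => s1.
  by rewrite lee_fin exprn_ge0// invr_ge0 (le_trans ler01).
by rewrite integral_invX.
Qed.
End Moments.

(** * Moments of the planar Gaussian and Gamma at positive integers *)

Section GaussianMoments.
Context {R : realType}.
Local Notation leb := (@lebesgue_measure R).
Local Notation mu := (@plane_measure R).

Lemma integral_plane_gauss : (\int[mu]_p (expR (- sqnorm p))%:E = pi%:E)%E.
Proof.
rewrite integral_planeE//; last first.
  apply/measurable_EFinP; apply: measurableT_comp => //.
  by apply: measurableT_comp => //; exact: measurable_sqnorm.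
transitivity (\int[leb]_u ((Num.sqrt pi)%:E * (gauss_fun u)%:E))%E.
  apply: eq_integral => u _.
  transitivity (\int[leb]_v ((gauss_fun u)%:E * (gauss_fun v)%:E))%E.
    apply: eq_integral => v _; rewrite -EFinM; congr EFin.
    by rewrite /sqnorm /gauss_fun /= opprD expRD.
  rewrite ge0_integralZl//.
  - by rewrite integralT_gauss muleC.
  - by apply/measurable_EFinP; exact: measurable_gauss_fun.
  - by move=> v _; rewrite lee_fin gauss_fun_ge0.
  - by rewrite lee_fin gauss_fun_ge0.
rewrite ge0_integralZl//.
- by rewrite integralT_gauss -EFinM -expr2 sqr_sqrtr// pi_ge0.
- by apply/measurable_EFinP; exact: measurable_gauss_fun.
- by move=> v _; rewrite lee_fin gauss_fun_ge0.
Qed.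

Let moment (n : nat) (s : R) : plane R -> \bar R :=
  fun p => (sqnorm p ^+ n * expR (- (s * sqnorm p)))%:E.

Let moment_ge0 n s p : (0 <= moment n s p)%E.
Proof. by rewrite lee_fin mulr_ge0 ?expR_ge0// exprn_ge0// sqnorm_ge0. Qed.

Let measurable_moment n s : measurable_fun setT (moment n s).
Proof.
apply/measurable_EFinP; apply: measurable_funM.
  by apply: measurable_funX; exact: measurable_sqnorm.
apply: measurableT_comp => //; apply: measurableT_comp => //.
by apply: measurable_funM => //; exact: measurable_sqnorm.
Qed.

(** Multiplication by the square root of s scales [sqnorm] by s: the Jacobian gives one factor s and
    the integrand n more. *)
Let integral_moment_scale n s : 0 < s ->
  (\int[mu]_p moment n s p = \int[mu]_p moment n 1 p * (s^-1 ^+ n.+1)%:E)%E.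
Proof.
move=> s0; pose c : R[i] := (Num.sqrt s)%:C%C.
have c0 : complex.Re c != 0 by rewrite /= gt_eqF// sqrtr_gt0.
have nc : sqnorm (ofC c) = s.
  by rewrite /sqnorm /= sqr_sqrtr ?ltW// expr0n addr0.
rewrite (integral_plane_mul c0 (measurable_moment n 1))// nc.
transitivity (s%:E * ((s ^+ n)%:E * \int[mu]_p moment n s p) * (s^-1 ^+ n.+1)%:E)%E.
  rewrite muleA -EFinM -exprS muleC muleA -EFinM -exprMn mulVf ?gt_eqF//.
  by rewrite expr1n mul1e.
congr (_ * _ * _)%E; rewrite -ge0_integralZl//; last first.
  by rewrite lee_fin exprn_ge0// ltW.
apply: eq_integral => p _; rewrite /moment sqnorm_mul nc -EFinM.
by rewrite exprMn mul1r mulrA.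
Qed.

Let measurable_fst_neq0 : measurable_fun setT (fun p : plane R => (p.1 != 0)%:R : R).
Proof.
rewrite (_ : (fun _ => _) = \1_(~` ([set 0] `*` setT))).
  by apply: measurable_indic; apply: measurableC; exact: measurableX.
apply/funext => -[u v]; rewrite indicE in_setC in_setX in_setT andbT.
by congr (_%:R : R); congr (~~ _); apply/eqP/idP => [->|]; rewrite inE.
Qed.

(** The weight [(p.1 != 0)%:R] is the [h] required by [moment_step]: it confines the integral to
    points where [sqnorm] is positive, at the cost of a null set. *)
Let ae_moment n s : (\int[mu]_p ((p.1 != 0)%:R * sqnorm p ^+ n * expR (- (s * sqnorm p)))%:E =
  \int[mu]_p moment n s p)%E.
Proof.
apply: ge0_ae_eq_integral => //.
- apply/measurable_EFinP; under eq_fun do rewrite -mulrA.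
  by apply: measurable_funM => //; apply/measurable_EFinP; exact: measurable_moment.
- by move=> p _; rewrite -mulrA lee_fin mulr_ge0 ?ler0n//; exact: moment_ge0.
- apply: filterS (@ae_plane_neq0 R) => p p0 _.
  by rewrite p0 mul1r.
Qed.

(** Scaling reduces to s = 1, where [moment_step] says that the n-th moment is the next one divided
    by n+1. *)
Lemma integral_plane_moment n s : 0 < s ->
  (\int[mu]_p (sqnorm p ^+ n * expR (- (s * sqnorm p)))%:E =
   (pi * n`!%:R * s^-1 ^+ n.+1)%:E)%E.
Proof.
move=> s0; rewrite (integral_moment_scale n s0) EFinM; congr (_ * _)%E.
elim: n => [|n IHn].
  rewrite mulr1 -integral_plane_gauss; apply: eq_integral => p _.
  by rewrite /moment expr0 !mul1r.
(* The next moment might be infinite a priori; its finiteness comes out of the recursion, since the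
   n-th moment is finite. *)
set c := (\int[mu]_p moment n.+1 1 p)%E.
have c0 : (0 <= c)%E by apply: integral_ge0 => p _; exact: moment_ge0.
have : (\int[mu]_p moment n 1 p = c * (n.+1%:R^-1)%:E)%E.
  rewrite -ae_moment.
  under eq_integral do rewrite mul1r.
  apply: moment_step => // [|p|s' s1].
  - exact: measurable_sqnorm.
  - have [|p0 _] := eqVneq p.1 0; first by rewrite eqxx.
    by rewrite /sqnorm ltr_wpDr ?sqr_ge0// exprn_even_gt0.
  - by rewrite ae_moment integral_moment_scale// (lt_le_trans ltr01).
rewrite IHn => /(congr1 (fun x => x * (n.+1%:R)%:E)%E).
rewrite -muleA -!EFinM mulVf ?pnatr_eq0// mule1 => <-.
by rewrite factS natrM -mulrA [n`!%:R * _]mulrC.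
Qed.


(** The recursion of the planar moments, now on the real line with the indicator of x > 0 as weight
    and [integral_affine] for the scaling. *)
Lemma euler_Gamma_nat n : euler_Gamma (n.+1%:R : R) = n`!%:R.
Proof.
pose h : R -> R := \1_(`]0, +oo[).
have hE x : h x = (0 < x)%R%:R by rewrite /h indicE mem_setE in_itv/= andbT.
pose f m s x : \bar R := (h x * x ^+ m * expR (- (s * x)))%:E.
have f0 m s x : (0 <= f m s x)%E.
  rewrite lee_fin hE; case: ltP => x0; last by rewrite !mul0r.
  by rewrite mul1r mulr_ge0 ?expR_ge0// exprn_ge0// ltW.
have mh : measurable_fun setT h by exact: measurable_indic.
have mf m s : measurable_fun setT (f m s).
  apply/measurable_EFinP; apply: measurable_funM; first exact: measurable_funM.
  by apply: measurableT_comp => //; apply: measurableT_comp => //; exact: measurable_funM.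
have scale m s : 0 < s ->
    (\int[leb]_x f m s x = \int[leb]_x f m 1%R x * (s^-1 ^+ m.+1)%:E)%E.
  move=> s0; rewrite (integral_affine 0 (lt0r_neq0 s0) (mf m 1))// gtr0_norm//.
  transitivity (s%:E * ((s ^+ m)%:E * \int[leb]_x f m s x) * (s^-1 ^+ m.+1)%:E)%E.
    rewrite muleA -EFinM -exprS muleC muleA -EFinM -exprMn mulVf ?gt_eqF//.
    by rewrite expr1n mul1e.
  congr (_ * _ * _)%E; rewrite -ge0_integralZl//; last 2 first.
  - exact: mf.
  - by rewrite lee_fin exprn_ge0// ltW.
  apply: eq_integral => x _; rewrite /f -EFinM addr0; congr EFin.
  by rewrite !hE pmulr_rgt0// exprMn mul1r; ring.
suff fn : (\int[leb]_x f n 1%R x = (n`!%:R)%:E)%E.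
  rewrite -[RHS]/(fine (n`!%:R)%:E) -fn; congr fine; rewrite integral_mkcond.
  apply: eq_integral => x _; rewrite epatch_indic /f /= -/(h x) hE -EFinM; congr EFin.
  case: ltP => x0; last by rewrite mulr0 !mul0r.
  by rewrite mulr1 mul1r mul1r -natr1 addrK powR_mulrn// ltW.
elim: n => [|n IHn].
  transitivity (\int[leb]_(s in `]0%R, +oo[) (1 * expR (- (s * 1)))%:E)%E.
    rewrite [RHS]integral_mkcond; apply: eq_integral => x _.
    by rewrite epatch_indic /f /= -/(h x) -EFinM !mul1r !mulr1 mulrC.
  rewrite integral_itv_obnd_cbnd.
    by rewrite integral_expRN// mul0r oppr0 expR0.
  apply: measurable_funTS; apply/measurable_EFinP; apply: measurable_funM => //.
  by apply: measurableT_comp => //; apply: measurableT_comp => //; exact: measurable_funM.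
set c := (\int[leb]_x f n.+1 1%R x)%E.
have c0 : (0 <= c)%E by apply: integral_ge0 => x _; exact: f0.
have : (\int[leb]_x f n 1%R x = c * (n.+1%:R^-1)%:E)%E.
  rewrite /f; under eq_integral do rewrite mul1r.
  apply: moment_step => // [x|s s1].
  - by rewrite hE; case: ltP => //; rewrite eqxx.
  - by rewrite -/(f n.+1 s) scale// (lt_le_trans ltr01).
rewrite IHn => /(congr1 (fun x => x * (n.+1%:R)%:E)%E).
rewrite -muleA -!EFinM mulVf ?pnatr_eq0// mule1 => <-.
by rewrite factS natrM mulrC.
Qed.
End GaussianMoments.

(** * Integration over CP^n *)

Section ChartIntegrals.
Context {R : realType}.
Local Notation C := R[i].
Local Notation mu := (@plane_measure R).

Definition tsqnorm n (z : n.-tuple (plane R)) : R := \sum_(j < n) sqnorm (tnth z j).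

Lemma tsqnorm_ge0 n (z : n.-tuple (plane R)) : 0 <= tsqnorm z.
Proof. by apply: sumr_ge0 => j _; exact: sqnorm_ge0. Qed.

Lemma measurable_tsqnorm n : measurable_fun setT (@tsqnorm n).
Proof.
apply: measurable_sum => j.
by apply: (measurableT_comp measurable_sqnorm); exact: measurable_tnth.
Qed.

Lemma tsqnorm_tinsert n (k : 'I_n.+1) t (w : n.-tuple (plane R)) :
  tsqnorm (tinsert k t w) = sqnorm t + tsqnorm w.
Proof.
rewrite /tsqnorm (bigD1_ord k)//= tnth_mktuple unlift_none; congr (_ + _).
by apply: eq_bigr => j _; rewrite tnth_mktuple liftK.
Qed.

Lemma tsqnorm_cscale n (c : C) (w : n.-tuple (plane R)) :
  tsqnorm (Defs.cscale c w) = sqnorm (ofC c) * tsqnorm w.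
Proof.
by rewrite mulr_sumr; apply: eq_bigr => j _; rewrite tnth_mktuple sqnorm_mul.
Qed.

(** The inserted [t] is t times the 1 placed by [chart k]. Homogeneity of the partition functions
    then removes t from their argument. *)
Lemma tinsert_cscale n (k : 'I_n.+1) (t : plane R) (w : n.-tuple (plane R)) :
  tinsert k t (Defs.cscale (toC t) w) = Defs.cscale (toC t) (chart k w).
Proof.
apply: eq_from_tnth => j; rewrite !tnth_mktuple.
case: unlift => [a|]; first by rewrite tnth_mktuple.
by rewrite ofC_mul_toC; case: t => u v /=; rewrite !mulr1 !mulr0 subr0 add0r.
Qed.

Lemma measurable_chart n (k : 'I_n.+1) :
  measurable_fun setT (fun w : n.-tuple (plane R) => chart k w).
Proof. exact: (measurableT_comp (measurable_tinsert k) (pair1_measurable (ofC 1))). Qed.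

Lemma integral_lebesgueC_gauss n :
  (\int[lebesgueC R n]_z (expR (- tsqnorm z))%:E = (pi ^+ n)%:E)%E.
Proof.
have mE m : measurable_fun setT (fun z : m.-tuple (plane R) => (expR (- tsqnorm z))%:E).
  apply/measurable_EFinP; apply: measurableT_comp => //.
  by apply: measurableT_comp => //; exact: measurable_tsqnorm.
elim: n => [|n IHn].
  by rewrite integral_lebesgueC0// /tsqnorm big_ord0 oppr0 expR0.
rewrite (integral_tinsert ord0)//.
transitivity (\int[mu]_t ((pi ^+ n)%:E * (expR (- sqnorm t))%:E))%E.
  apply: eq_integral => t _; rewrite muleC -IHn -ge0_integralZl//; last exact: mE.
  by apply: eq_integral => w _; rewrite tsqnorm_tinsert opprD expRD.
rewrite ge0_integralZl//; last 2 first.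
- apply/measurable_EFinP; apply: measurableT_comp => //.
  by apply: measurableT_comp => //; exact: measurable_sqnorm.
- by rewrite lee_fin exprn_ge0// pi_ge0.
by rewrite integral_plane_gauss -EFinM exprSr.
Qed.

(** Up to a constant, the Fubini-Study density of the ordinary CP^n in an affine chart. *)
Definition FS_density n (w : n.-tuple (plane R)) : R := (1 + tsqnorm w)^-1 ^+ n.+1.

Lemma FS_density_ge0 n (w : n.-tuple (plane R)) : 0 <= FS_density w.
Proof. by rewrite exprn_ge0// invr_ge0 addr_ge0// tsqnorm_ge0. Qed.

Lemma measurable_FS_density n : measurable_fun setT (@FS_density n).
Proof.
rewrite (_ : @FS_density n = fun w => ((1 + tsqnorm w) `^ (- 1)) ^+ n.+1).
  apply: measurable_funX; apply: (measurableT_comp (f := @powR R ^~ (- 1))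
    (g := fun w : n.-tuple (plane R) => 1 + tsqnorm w)); first exact: measurable_powR.
  by apply: measurable_funD => //; exact: measurable_tsqnorm.
by apply/funext => w; rewrite powRN powRr1// addr_ge0// tsqnorm_ge0.
Qed.

(* Substituting z = t (1, w) in the Gaussian integral over C^(n+1), the
   homogeneity of rho leaves the integral of |t|^2n exp (- (1 + |w|^2) |t|^2). *)
Lemma integral_chart n (k : 'I_n.+1) (rho : n.+1.-tuple (plane R) -> R) :
  measurable_fun setT rho -> (forall z, 0 <= rho z) ->
  (forall (c : C) z, c != 0 -> rho (Defs.cscale c z) = rho z) ->
  (\int[lebesgueC R n.+1]_z (rho z * expR (- tsqnorm z))%:E =
   (pi * n`!%:R)%:E * \int[lebesgueC R n]_w (rho (chart k w) * FS_density w)%:E)%E.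
Proof.
move=> mrho rho0 rhoh.
pose f (z : n.+1.-tuple (plane R)) := (rho z * expR (- tsqnorm z))%:E.
have f0 z : (0 <= f z)%E by rewrite lee_fin mulr_ge0// expR_ge0.
have mf : measurable_fun setT f.
  apply/measurable_EFinP; apply: measurable_funM => //; apply: measurableT_comp => //.
  by apply: measurableT_comp => //; exact: measurable_tsqnorm.
pose g (p : plane R * n.-tuple (plane R)) := (rho (chart k p.2) *
  (sqnorm p.1 ^+ n * expR (- ((1 + tsqnorm p.2) * sqnorm p.1))))%:E.
have g0 p : (0 <= g p)%E.
  by rewrite lee_fin !mulr_ge0// ?expR_ge0// exprn_ge0// sqnorm_ge0.
have mg : measurable_fun setT g.
  have m1 : measurable_fun setT (fun p : plane R * n.-tuple (plane R) => sqnorm p.1).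
    by apply: (measurableT_comp measurable_sqnorm).
  apply/measurable_EFinP; apply: measurable_funM.
    apply: measurableT_comp => //.
    by apply: (measurableT_comp (measurable_chart k)).
  apply: measurable_funM; first exact: measurable_funX.
  apply: measurableT_comp => //; apply: measurableT_comp => //.
  apply: measurable_funM => //; apply: measurable_funD => //.
  by apply: (measurableT_comp (@measurable_tsqnorm n)).
rewrite (integral_tinsert k mf f0).
(* For Re t != 0 the inner variable is replaced by t w, whose Jacobian is |t|^(2n); the other t form
   a null set. *)
transitivity (\int[mu]_t \int[lebesgueC R n]_w g (t, w))%E.
  apply: ge0_ae_eq_integral => //.
  - apply: (measurable_fun_fubini_tonelli_F (m2 := lebesgueC R n)
      (fun p => f (tinsert k p.1 p.2))) => //.
    by apply: measurableT_comp mf _; exact: measurable_tinsert.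
  - exact: (measurable_fun_fubini_tonelli_F (m2 := lebesgueC R n) _ mg).
  - by move=> t _; exact: integral_ge0.
  - by move=> t _; exact: integral_ge0.
  apply: filterS (@ae_plane_neq0 R) => t t0 _.
  have t0' : toC t != 0 by apply: contra_neq t0 => /(congr1 (@complex.Re R)).
  have mft : measurable_fun setT (fun w => f (tinsert k t w)).
    apply: measurableT_comp mf _.
    exact: (measurableT_comp (measurable_tinsert k) (pair1_measurable t)).
  rewrite (integral_cscale (c := toC t) t0 mft (fun=> f0 _)) -ge0_integralZl; last 4 first.
  - exact: measurableT.
  - apply: measurableT_comp mft _.
    exact: (measurableT_comp (@measurable_cscale _ n) (pair1_measurable t)).
  - by move=> w _; exact: f0.
  - by rewrite lee_fin exprn_ge0// sqnorm_ge0.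
  apply: eq_integral => w _; rewrite /f /g -EFinM; congr EFin => /=.
  rewrite tsqnorm_tinsert tinsert_cscale rhoh// tsqnorm_cscale.
  rewrite (_ : ofC (toC t) = t); last by case: (t).
  by rewrite mulrCA; congr (_ * (_ * expR (- _))); ring.
rewrite (fubini_tonelli (m1 := mu) (m2 := lebesgueC R n) _ mg)//.
rewrite -ge0_integralZl//; last 3 first.
- apply/measurable_EFinP; apply: measurable_funM; last exact: measurable_FS_density.
  by apply: measurableT_comp mrho _; exact: measurable_chart.
- by move=> w _; rewrite lee_fin mulr_ge0// FS_density_ge0.
- by rewrite lee_fin mulr_ge0// pi_ge0.
apply: eq_integral => w _.
have s0 : 0 < 1 + tsqnorm w by rewrite ltr_wpDr// tsqnorm_ge0.
rewrite /g /=; under eq_integral do rewrite EFinM.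
rewrite ge0_integralZl//; last 3 first.
- apply/measurable_EFinP; apply: measurable_funM.
    by apply: measurable_funX; exact: measurable_sqnorm.
  apply: measurableT_comp => //; apply: measurableT_comp => //.
  by apply: measurable_funM => //; exact: measurable_sqnorm.
- by move=> t _; rewrite lee_fin !mulr_ge0// ?expR_ge0// exprn_ge0// sqnorm_ge0.
- by rewrite lee_fin.
by rewrite integral_plane_moment// -!EFinM mulrCA.
Qed.

Lemma integral_partition n (rho : 'I_n.+1 -> n.+1.-tuple (plane R) -> R) :
  partition_of_unity rho ->
  (\sum_(k < n.+1) \int[lebesgueC R n]_w (rho k (chart k w) * FS_density w)%:E =
   (pi ^+ n / n`!%:R)%:E)%E.
Proof.
move=> [mrho rho0 rhoh _ rho1].
set I := (\sum_(k < n.+1) _)%E.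
have pn0 : 0 < pi * n`!%:R :> R by rewrite mulr_gt0 ?pi_gt0// ltr0n fact_gt0.
suff : ((pi * n`!%:R)%:E * I = (pi ^+ n.+1)%:E)%E.
  move=> /(congr1 (fun x => (pi * n`!%:R)^-1%:E * x)%E).
  rewrite muleA -!EFinM mulVf ?gt_eqF// mul1e => ->; congr EFin.
  by rewrite exprS invfM mulrACA mulVf ?gt_eqF ?pi_gt0// mul1r mulrC.
rewrite /I ge0_sume_distrr; last first.
  by move=> k _; apply: integral_ge0 => w _; rewrite lee_fin mulr_ge0// FS_density_ge0.
transitivity (\sum_(k < n.+1) \int[lebesgueC R n.+1]_z (rho k z * expR (- tsqnorm z))%:E)%E.
  by apply: eq_bigr => k _; rewrite (integral_chart k (mrho k) (rho0 k) (rhoh k)).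
have me k : measurable_fun setT (fun z => (rho k z * expR (- tsqnorm z))%:E).
  apply/measurable_EFinP; apply: measurable_funM => //; apply: measurableT_comp => //.
  by apply: measurableT_comp => //; exact: measurable_tsqnorm.
have e0 k z : (0 <= (rho k z * expR (- tsqnorm z))%:E)%E.
  by rewrite lee_fin mulr_ge0// expR_ge0.
rewrite -ge0_integral_sum//.
have mE : measurable_fun setT (fun z : n.+1.-tuple (plane R) => (expR (- tsqnorm z))%:E).
  apply/measurable_EFinP; apply: measurableT_comp => //.
  by apply: measurableT_comp => //; exact: measurable_tsqnorm.
have mS : measurable_fun setT
    (fun z => \sum_(k < n.+1) (rho k z * expR (- tsqnorm z))%:E)%E.
  exact: emeasurable_sum.
have S0 z : (0 <= \sum_(k < n.+1) (rho k z * expR (- tsqnorm z))%:E)%E.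
  by apply: sume_ge0.
have mcons t : measurable_fun setT (fun w : n.-tuple (plane R) => tinsert ord0 t w).
  exact: (measurableT_comp (measurable_tinsert ord0) (pair1_measurable t)).
(* The functions [rho k] sum to 1 only away from the origin. Splitting off coordinate 0 discards the
   origin together with the null set Re t = 0. *)
rewrite -integral_lebesgueC_gauss !(integral_tinsert ord0)//.
apply: ge0_ae_eq_integral => //.
- apply: (measurable_fun_fubini_tonelli_F (m2 := lebesgueC R n) (fun p =>
    \sum_(k < n.+1) (rho k (tinsert ord0 p.1 p.2) *
      expR (- tsqnorm (tinsert ord0 p.1 p.2)))%:E)%E) => //.
  exact: (measurableT_comp mS (measurable_tinsert ord0)).
- apply: (measurable_fun_fubini_tonelli_F (m2 := lebesgueC R n) (fun p =>
    (expR (- tsqnorm (tinsert ord0 p.1 p.2)))%:E)) => //.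
  exact: (measurableT_comp mE (measurable_tinsert ord0)).
- by move=> t _; apply: integral_ge0.
- by move=> t _; apply: integral_ge0 => w _; rewrite lee_fin expR_ge0.
apply: filterS (@ae_plane_neq0 R) => t t0 _.
apply: eq_integral => w _; rewrite sumEFin -mulr_suml rho1 ?mul1r//.
exists ord0; rewrite tnth_mktuple unlift_none.
by apply: contra_neq t0 => /(congr1 (@complex.Re R)).
Qed.
End ChartIntegrals.

(** * The volume of CP^(n|m) *)

Section RGamma.
Context {R : realType}.

Lemma prod_rising (a k : nat) :
  (\prod_(i < k) (a.+1%:R + i%:R)) * a`!%:R = (a + k)`!%:R :> R.
Proof.
elim: k => [|k IHk]; first by rewrite big_ord0 mul1r addn0.
by rewrite big_ord_recr /= mulrAC IHk addnS factS natrM mulrC -natrD addSn.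
Qed.

(** At a+1 the shift in [rGamma] is k = a+2, so the rising product (a+1) ... (a+k) is divided by
    Gamma(a+1+k) = (a+k)!, which leaves 1 / a!. *)
Lemma rGamma_nat (a : nat) : rGamma (a.+1%:R : R) = a`!%:R^-1.
Proof.
have fl : Num.floor (a.+1%:R : R) = a.+1%:Z by exact: (intrKfloor a.+1%:Z).
rewrite /rGamma fl absz_nat -natrD addSn euler_Gamma_nat -prod_rising.
have a0 : a`!%:R != 0 :> R by rewrite pnatr_eq0 -lt0n fact_gt0.
rewrite invfM mulrA divff ?mul1r// prodf_seq_neq0; apply/allP => i _.
by rewrite implyTb -natrD pnatr_eq0.
Qed.

(** Here k = b+1, and the last factor of the product is - b + b. *)
Lemma rGamma_opp_nat (b : nat) : rGamma (- b%:R : R) = 0.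
Proof.
have fl : Num.floor (- b%:R : R) = - b%:Z.
  by rewrite -(intrKfloor (R := R) (- b%:Z)) rmorphN.
by rewrite /rGamma fl abszN absz_nat big_ord_recr /= addNr mulr0 mul0r.
Qed.

(** For m <= n the product (n-m+1) ... n is n! / (n-m)!. For m > n the argument is a pole of Gamma,
    and the product contains 0. *)
Lemma prod_div_fact (n m : nat) :
  (\prod_(i < m) (n%:R - m%:R + 1 + i%:R)) / n`!%:R = rGamma (n%:R - m%:R + 1 : R).
Proof.
have [le_mn|lt_nm] := leqP m n.
  have -> : n%:R - m%:R + 1 = (n - m).+1%:R :> R by rewrite -natrB// natr1.
  have f0 k : k`!%:R != 0 :> R by rewrite pnatr_eq0 -lt0n fact_gt0.
  by rewrite rGamma_nat -[X in _ / X`!%:R](subnK le_mn) -prod_rising invfM mulVKf//;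
    apply/prodf_neq0 => i _; rewrite -natrD pnatr_eq0.
have -> : n%:R - m%:R + 1 = - (m - n.+1)%:R :> R by rewrite natrB// -natr1; ring.
rewrite rGamma_opp_nat (_ : \prod_(i < m) _ = 0) ?mul0r//.
(* The index of the vanishing factor: n - m + 1 + (m - n - 1) = 0. *)
have lt_bm : (m - n.+1 < m)%N by lia.
by rewrite (bigD1 (Ordinal lt_bm))//= addNr mul0r.
Qed.
End RGamma.

(** * Odd integration of the Fubini-Study volume element *)

Section FubiniStudyDensity.
Context {R : realType}.
Local Notation C := R[i].

Lemma theta_thetabar m (mu : 'I_m) :
  'i%C *: (theta R mu * thetabar R mu) = 2 *: gmono C (odd_pairs [set mu]%SET).
Proof.
(* A repeated generator gives 0; for distinct ones the sign is -1 exactly when the first is tau^mu,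
   because tau^mu sigma^mu = - sigma^mu tau^mu. *)
have gM b b' : ggen C ((mu, b) : odd_coords m) * ggen C ((mu, b') : odd_coords m) =
    (if b == b' then 0 else (-1) ^+ b) *: gmono C (odd_pairs [set mu]%SET).
  rewrite -/(gmono C [set ((mu, b) : odd_coords m)]%SET).
  rewrite -/(gmono C [set ((mu, b') : odd_coords m)]%SET) gmonoM /gsign.
  rewrite disjoints1 finset.in_set1 xpair_eqE eqxx /=.
  have [_|bb] := eqVneq b b'; first by rewrite !scale0r.
  rewrite /inversions !finset.big_set1 /=; congr (_ *: gmono C _).
    congr (_ ^+ _); rewrite Order.ProdLexiOrder.ltEprodlexi /= lexx /=.
    by case: b b' bb => [] [].
  apply/setP => -[nu b'']; rewrite !finset.inE !xpair_eqE -andb_orr.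
  by case: b b' b'' bb => [] [] []; rewrite ?andbT.
rewrite /theta /thetabar mulrDl !mulrBr -!scalerAr -!scalerAl !gM /=.
rewrite expr0 expr1 !scale0r !scaler0 scale1r scaleN1r sub0r subr0 scalerN.
rewrite -opprD scalerN -scalerDl scalerA -scaleNr; congr (_ *: _).
by apply/eqP; rewrite eq_complex /=; apply/andP; split; apply/eqP; ring.
Qed.

Lemma FS_NE n m (w : n.-tuple (plane R)) :
  FS_N m w = ((1 + tsqnorm w)%:C%C)%:A + 2 *: pair_sum m C 1.
Proof.
rewrite /FS_N scaler_sumr (eq_bigr _ (fun mu _ => theta_thetabar mu)) -scaler_sumr -pair_sum1.
congr (_ + _); rewrite rmorphD rmorph1 scalerDl scale1r rmorph_sum scaler_suml.
congr (_ + _); apply: eq_bigr => a _; congr (_ *: _); rewrite /toC /sqnorm /=.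
case: (tnth w a) => u v /=.
by apply/eqP; rewrite eq_complex /=; apply/andP; split; apply/eqP; ring.
Qed.

(** The determinant of a block is -2i, and (i/2)(-2i) = 1: the prefactor exactly undoes the passage
    from real to complex coordinates. *)
Lemma complex_volumeE n m : ('i%C / 2) ^ (n%:Z - m%:Z) * complex_volume R n m = 1.
Proof.
rewrite /complex_volume -expfzMl.
rewrite (expand_det_row _ ord0) !big_ord_recl big_ord0 /cofactor !det_mx11 !mxE /=.
rewrite [X in X ^ _](_ : _ = 1) ?exp1rz// /bump /= addn0 add0n expr0 expr1.
set i := 'i%C; rewrite (_ : _ * _ = - (i ^+ 2)); last by field.
by rewrite complex.sqr_i opprK.
Qed.

Definition FS_const n m (r : R) : R :=
  r ^ (2 * (n%:Z - m%:Z)) * (2 ^+ m * \prod_(i < m) (n%:R - m%:R + 1 + i%:R)).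

(** The sign (-1)^m in the normalization of the odd integral cancels the one from the falling
    factorial of -(n-m+1); the factor 2^m is c^m for c = 2. *)
Lemma odd_integral_cutoff n m (r : R) (rho : 'I_n.+1 -> n.+1.-tuple (plane R) -> R) k
    (w : n.-tuple (plane R)) :
  odd_integral (cutoff rho (fun=> @FS_volume R n m r) k) w =
  (FS_const n m r * (rho k (chart k w) * FS_density w))%:C%C.
Proof.
have s0 : 1 + tsqnorm w != 0 by rewrite gt_eqF// ltr_wpDr// tsqnorm_ge0.
have sC0 : (1 + tsqnorm w)%:C%C != 0 :> C by rewrite fmorph_eq0.
rewrite /odd_integral /cutoff /FS_volume /gtop !ffunE.
rewrite -mulrA complex_volumeE mulr1 FS_NE.
rewrite -/(gtop (_ ^ _)) (gtop_pair_power m 2 sC0).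
have -> : - (n%:Z - m%:Z + 1) - m%:Z = - n.+1%:Z by rewrite intS; ring.
rewrite -exprnN -exprVn.
have -> : zfalling (- (n%:Z - m%:Z + 1)) m =
    (-1) ^+ m * \prod_(i < m) (n%:Z - m%:Z + 1 + i%:Z).
  by rewrite /zfalling -[m in (-1) ^+ m]card_ord -prodrN; apply: eq_bigr => i _; ring.
have -> : ((-1) ^+ m * \prod_(i < m) (n%:Z - m%:Z + 1 + i%:Z))%:~R =
    (-1) ^+ m * (\prod_(i < m) (n%:R - m%:R + 1 + i%:R : R))%:C%C :> C.
  rewrite rmorphM rmorphXn rmorphN1 rmorph_prod (rmorph_prod (real_complex R)).
  congr (_ * _); apply: eq_bigr => i _.
  by rewrite !rmorphD !rmorphN /= !rmorph1 !rmorph_nat.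
rewrite /FS_const /FS_density /GRing.scale /= !(rmorphM (real_complex R)).
rewrite !(rmorphXn (real_complex R)) !(fmorphV (real_complex R)) (fmorphXz (real_complex R)).
rewrite !(rmorph_nat (real_complex R)) -[RHS](signrMK m); ring.
Qed.


(** Let [rho k] be the indicator of the points whose first nonzero coordinate is the k-th. This is
    Borel and homogeneous, and exactly one of these indicators is 1 at each nonzero point. *)
Lemma exists_partition_of_unity n :
  exists rho : 'I_n.+1 -> n.+1.-tuple (plane R) -> R, partition_of_unity rho.
Proof.
pose nz (z : n.+1.-tuple (plane R)) (j : 'I_n.+1) := toC (tnth z j) != 0.
pose rho (k : 'I_n.+1) z : R := (nz z k)%:R *
  \prod_(j < n.+1) (if (j < k)%N then (~~ nz z j)%:R else 1).
(* The exclusive or treats the indicators of z_j != 0 and of z_j = 0 together. *)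
have mnz (b : bool) j : measurable_fun setT (fun z => (b (+) nz z j)%:R : R).
  rewrite (_ : (fun z => _) = fun z =>
      if sqnorm (tnth z j) == 0 then b%:R else (~~ b)%:R); last first.
    apply/funext => z; rewrite /nz; case: (tnth z j) => u v.
    rewrite eq_complex /sqnorm /= paddr_eq0 ?sqr_ge0// !sqrf_eq0.
    by case: ifP => _; case: b.
  apply: measurable_fun_ifT => //.
  apply: measurable_fun_eqr => //.
  by apply: (measurableT_comp measurable_sqnorm); exact: measurable_tnth.
exists rho; split.
- move=> k; apply: measurable_funM; first exact: (mnz false).
  apply: measurable_prod => j _; have [_|_] := boolP (j < k)%N; first exact: (mnz true).
  exact: measurable_cst.
- move=> k z; rewrite mulr_ge0// prodr_ge0// => j _; case: ifP => // _; exact: ler0n.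
- move=> k c z c0; have nzc j : nz (Defs.cscale c z) j = nz z j.
    rewrite /nz tnth_mktuple (_ : toC (ofC _) = c * toC (tnth z j)) ?mulf_eq0 ?(negbTE c0)//.
    by case: (c * _).
  by rewrite /rho nzc; congr (_ * _); apply: eq_bigr => j _; rewrite nzc.
- by move=> k z zk; rewrite /rho /nz zk eqxx mul0r.
move=> z [j0 zj0].
have [k zk kmin] := @arg_minnP _ j0 (nz z) (@nat_of_ord _) zj0.
rewrite (bigD1 k)//= big1 ?addr0 => [|j jk].
  rewrite /rho zk mul1r big1// => j _; case: ifP => // jk.
  by case: (boolP (nz z j)) => // /kmin; rewrite leqNgt jk.
rewrite /rho; have [zj|zj] := boolP (nz z j); last by rewrite mul0r.
have kj : (k < j)%N by rewrite ltn_neqAle kmin// andbT eq_sym.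
by rewrite (bigD1 k)//= kj zk mul0r mulr0.
Qed.

End FubiniStudyDensity.

Theorem theorem2 (R : realType) (n m : nat) (r : R) (hr : 0 < r) :
  is_volume_CP n m r
    ((r ^ (2 * (n%:Z - m%:Z)) * (pi ^+ n * 2 ^+ m * rGamma (n%:R - m%:R + 1)))%:C%C).
Proof.
split; first exact: exists_partition_of_unity.
move=> rho hrho; have [mrho rho0 _ _ _] := hrho.
pose mu := lebesgueC R n.
pose f k (w : n.-tuple (plane R)) : R := rho k (chart k w) * FS_density w.
have f0 k w : 0 <= f k w by rewrite mulr_ge0// FS_density_ge0.
have sum_f := integral_partition hrho.
have If k : mu.-integrable setT (EFin \o f k).
  apply/integrableP; split.
    apply/measurable_EFinP; apply: measurable_funM; last exact: measurable_FS_density.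
    by apply: measurableT_comp (mrho k) _; exact: measurable_chart.
  (* Each piece is nonnegative, hence bounded by the finite total pi^n / n!. *)
  under eq_integral do rewrite /= ger0_norm//.
  apply: le_lt_trans (ltry (pi ^+ n / n`!%:R)); rewrite -sum_f (bigD1 k)//= leeDl//.
  by apply: sume_ge0 => j _; apply: integral_ge0 => w _; rewrite lee_fin; exact: f0.
pose c := FS_const n m r.
have ReE k : (fun w => complex.Re (odd_integral (cutoff rho (fun=> @FS_volume R n m r) k) w)) =
    (fun w => c * f k w).
  by apply/funext => w; rewrite odd_integral_cutoff.
have ImE k : (fun w => complex.Im (odd_integral (cutoff rho (fun=> @FS_volume R n m r) k) w)) =
    cst 0.
  by apply/funext => w; rewrite odd_integral_cutoff.
split=> [k|].
  split.
    rewrite [X in _.-integrable _ X](_ : _ = (fun w => c%:E * (EFin \o f k) w)%E).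
      exact: integrableZl.
    by apply/funext => w; rewrite -/(EFin _) -EFinM (congr1 (fun g => g w) (ReE k)).
  rewrite [X in _.-integrable _ X](_ : _ = cst 0%E); first exact: integrable0.
  by apply/funext => w; rewrite /= (congr1 (fun g => g w) (ImE k)).
transitivity (\sum_(k < n.+1) (c * Rintegral mu setT (f k))%:C%C).
  apply: eq_bigr => k _; rewrite /berezin_integral ReE ImE RintegralZl//.
  by rewrite /Rintegral integral0.
rewrite -(rmorph_sum (real_complex R)) -mulr_sumr; congr (_%:C%C).
have -> : \sum_(k < n.+1) Rintegral mu setT (f k) = pi ^+ n / n`!%:R.
  rewrite -[RHS]/(fine (pi ^+ n / n`!%:R)%:E) -sum_f -sum_fine// => k _.
  exact: (integrable_fin_num measurableT (If k)).
rewrite /c /FS_const -prod_div_fact; ring.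
Qed.
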